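(* For every $m\ge1$ let $X^{(m)}_1,\dots,X^{(m)}_m$ be independent random variables with mean zero and finite variance, and set $\sigma_m:=\sqrt{\frac1m\sum_{i=1}^m\mathrm{Var}(X^{(m)}_i)}$. Suppose $\sigma_m\ge1$ for all $m$, and that there exist constants $\delta\in[0,1)$ and $C\ge1$ such that for all $m\ge1$, $i=1,\dots,m$ and $j\ge2$, $$\mathbb{E}\big[|X^{(m)}_i|^j\big]\le j!\,(C\sigma_m)^{(1+\delta)j}.$$ Let $F_m$ be the distribution function of $(X^{(m)}_1+\dots+X^{(m)}_m)/(\sigma_m\sqrt m)$ and $\Phi$ the standard Gaussian distribution function. Assume $\sigma_m^\delta/m^{1/6}\to0$. Then for any sequence $(x_m)$ with $x_m\to\infty$ and $x_m\sigma_m^\delta/m^{1/6}\to0$, $$1-F_m(x_m)=\Big[1+O\Big(\sigma_m^{3\delta}\frac{x_m^3}{\sqrt m}\Big)\Big]\big[1-\Phi(x_m)\big]\quad\text{as }m\to\infty.$$ *)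

(* Defs.v *)
From HB Require Import structures.
From mathcomp Require Import all_boot all_order all_algebra.
From mathcomp Require Import all_classical all_reals all_analysis.
Set Implicit Arguments. Unset Strict Implicit. Unset Printing Implicit Defensive.
Import Order.TTheory GRing.Theory Num.Theory.
Import numFieldNormedType.Exports.
Local Open Scope classical_set_scope.
Local Open Scope ring_scope.

(* Mutual independence of a finite family of real random variables:
   product rule for preimages of arbitrary Borel sets (taking B i = setT
   recovers the product rule for every subfamily). *)
Definition mutually_independent {d} {T : measurableType d} {R : realType}
  (P : probability T R) (n : nat) (Y : 'I_n -> T -> R) : Prop :=
  forall B : 'I_n -> set R, (forall i, measurable (B i)) ->
    P (\bigcap_(i in [set: 'I_n]) (Y i @^-1` B i)) =
    (\prod_(i < n) P (Y i @^-1` B i))%E.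

Definition sigma_row {d} {R : realType} {T : nat -> measurableType d}
  (P : forall m, probability (T m) R) (X : forall m, 'I_m -> T m -> R)
  (m : nat) : R :=
  Num.sqrt (m%:R^-1 * \sum_(i < m) fine ('V_(P m)[X m i])).

Definition F_row {d} {R : realType} {T : nat -> measurableType d}
  (P : forall m, probability (T m) R) (X : forall m, 'I_m -> T m -> R)
  (m : nat) (x : R) : R :=
  fine (P m [set w | (\sum_(i < m) X m i w) / (sigma_row P X m * Num.sqrt m%:R) <= x]).

Definition Phi {R : realType} (x : R) : R :=
  fine (normal_prob 0 1 [set y : R | y <= x]).

(* Main.v *)
(** Tilt the law exponentially, then apply Stein's method.

    Let [Y_i = X_i / (sigma sqrt m)], [S = sum Y_i] and
    [h = (C sigma)^(1+delta) / (sigma sqrt m)], so that [E|Y_i|^j <= j! h^j] and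
    [m h^3] is [sigma^(3 delta) / sqrt m] up to a constant.  Under
    [dQ = e^(x S) / E(e^(x S)) dP] the [Y_i] are still independent, with [S] of
    mean [x + O(m h^3 x^2)] and variance [1 + O(m h^3 x)], and
    [ln E(e^(x S)) = x^2/2 + O(m h^3 x^3)].  Moreover
    [P(S > x) = E(e^(x S)) e^(-x^2) E_Q H(S - x)] with
    [H w = e^(-x w) 1_(w > 0)], while [1 - Phi x = e^(-x^2/2) E H(N(0,1))].

    Stein's equation for [H], solved explicitly with the Mills ratio, gives
    [E_Q H(S - x) = E H(N(0,1)) + O(m h^3 x^2)]; the jump of [H] at [0] is handled
    by a concentration inequality for sums of independent variables, itself
    proved by testing such a sum against a clipped identity.  Since
    [E H(N(0,1))] is of order [1 / x], this error is [O(m h^3 x^3)] relative to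
    it. *)
Require Import Defs.
From HB Require Import structures.
From mathcomp Require Import all_boot all_order all_algebra.
From mathcomp Require Import all_classical all_reals all_analysis.
From mathcomp Require Import measurable_realfun ring lra.
Set Implicit Arguments. Unset Strict Implicit. Unset Printing Implicit Defensive.
Import Order.TTheory GRing.Theory Num.Theory.
Import numFieldNormedType.Exports.
Local Open Scope classical_set_scope.
Local Open Scope ring_scope.

(** * Independence *)

(** The tilt is forced by scale: [1 - Phi x] is about [e^(-x^2/2) / x], far below any additive error
    that Stein's method gives for [S] itself. After the tilt both tails carry the same factor
    [e^(-x^2/2)], and the quantities left to compare are only of order [1 / x].

    The solution of Stein's equation and its derivative are bounded by absolute constants; [x]
    enters only through the variation of the derivative, and linearly. In the Stein step the
    dominant error is therefore the bias of the mean. It is not removed by adjusting the tilt, which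
    would spoil the clean factor [e^(-x^2)], but kept as a deterministic shift [c] of a centred sum.

    One smallness condition, [10000 x^3 m h^3 <= 1], is enough. The variances add up to [1] and each
    is at most [2 h^2], so [m h^2 >= 1/2]; the condition then makes [x h] small, and this is what
    provides exponential moments at [x]. All constants are explicit because the final one must be
    uniform in [m]; none is optimized. *)

Section independent_pair.
Context d d1 d2 (T : measurableType d) (T1 : measurableType d1)
  (T2 : measurableType d2) (R : realType) (P : probability T R).
Variables (Y : T -> T1) (Z : T -> T2).
Hypotheses (mY : measurable_fun setT Y) (mZ : measurable_fun setT Z).
Hypothesis indYZ : forall A B, measurable A -> measurable B ->
  P (Y @^-1` A `&` Z @^-1` B) = (P (Y @^-1` A) * P (Z @^-1` B))%E.

Let Ym : {mfun T >-> T1} := mfun_Sub (mem_set mY).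
Let Zm : {mfun T >-> T2} := mfun_Sub (mem_set mZ).

Let mYZ : measurable_fun setT (fun w => (Y w, Z w)).
Proof. exact/measurable_fun_pairP. Qed.

Let YZm : {mfun T >-> (T1 * T2)%type} := mfun_Sub (mem_set mYZ).

Let lawYZ (A : set (T1 * T2)) : measurable A ->
  distribution P YZm A = (distribution P Ym \x distribution P Zm)%E A.
Proof. by move=> mA; apply/esym/product_measure_unique. Qed.

(** Independence determines the law of the pair on rectangles, so it is the product law and Tonelli
    applies. [H] may couple its two arguments; [expectation_joint_le] needs this. *)
Lemma ge0_integral_indep (H : T1 * T2 -> \bar R) :
  measurable_fun setT H -> (forall z, 0 <= H z)%E ->
  (\int[P]_w H (Y w, Z w) = \int[P]_w \int[P]_w' H (Y w, Z w'))%E.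
Proof.
move=> mH H0.
have -> : (\int[P]_w H (Y w, Z w) = \int[distribution P YZm]_z H z)%E.
  by rewrite ge0_integral_pushforward.
rewrite (eq_measure_integral (distribution P Ym \x distribution P Zm)%E); last first.
  by move=> A mA _; exact: lawYZ.
rewrite fubini_tonelli1// ge0_integral_pushforward//.
- rewrite preimage_setT; apply: eq_integral => w _ /=.
  rewrite /fubini_F ge0_integral_pushforward//.
  by apply: measurableT_comp => //; exact: measurable_pair1.
- exact: measurable_fun_fubini_tonelli_F.
- by move=> y _; apply: integral_ge0 => z _.
Qed.

Lemma distribution_pair_indep : forall A, measurable A ->
  distribution P YZm A = (distribution P Ym \x distribution P Zm)%E A.
Proof. exact: lawYZ. Qed.

End independent_pair.

Section independent_product.
Context d (T : measurableType d) (R : realType) (P : probability T R).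
Variables (Y Z : T -> R).
Hypotheses (iY : P.-integrable setT (EFin \o Y))
  (iZ : P.-integrable setT (EFin \o Z)).
Hypothesis indYZ : forall A B : set R, measurable A -> measurable B ->
  P (Y @^-1` A `&` Z @^-1` B) = (P (Y @^-1` A) * P (Z @^-1` B))%E.

Let mY : measurable_fun setT Y.
Proof. exact/measurable_EFinP/(measurable_int P). Qed.

Let mZ : measurable_fun setT Z.
Proof. exact/measurable_EFinP/(measurable_int P). Qed.

(** First moments suffice: by Tonelli the integral of [|Y Z|] is the product of those of [|Y|] and
    [|Z|]. *)
Lemma integrable_indepM : P.-integrable setT (EFin \o (fun w => Y w * Z w)).
Proof.
have mnZ : measurable_fun setT (fun w => `|Z w|%:E).
  by apply/measurable_EFinP; exact: measurableT_comp.
have mnY : measurable_fun setT (fun w => `|Y w|%:E).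
  by apply/measurable_EFinP; exact: measurableT_comp.
have fZ : (\int[P]_w `|Z w|%:E)%E \is a fin_num.
  exact: integrable_fin_num (integrable_norm iZ).
have fY : (\int[P]_w `|Y w|%:E)%E \is a fin_num.
  exact: integrable_fin_num (integrable_norm iY).
apply/integrableP; split; first exact/measurable_EFinP/measurable_funM.
under eq_integral do rewrite /= normrM.
rewrite (ge0_integral_indep mY mZ indYZ (H := fun z => (`|z.1| * `|z.2|)%:E))/=.
- under eq_integral.
    move=> w _; under eq_integral do rewrite EFinM.
    rewrite ge0_integralZl//.
    over.
  rewrite /= -(fineK fZ) ge0_integralZr//.
    by rewrite -(fineK fY) -EFinM ltry.
  by rewrite lee_fin fine_ge0// integral_ge0.
- by apply/measurable_EFinP/measurable_funM; apply: measurableT_comp.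
- by move=> z; rewrite lee_fin.
Qed.

Lemma integral_indepM :
  \int[P]_w (Y w * Z w) = \int[P]_w Y w * \int[P]_w Z w.
Proof.
pose Ym : {mfun T >-> R} := mfun_Sub (mem_set mY).
pose Zm : {mfun T >-> R} := mfun_Sub (mem_set mZ).
have mYZ : measurable_fun setT (fun w => (Y w, Z w)).
  exact/measurable_fun_pairP.
pose YZm : {mfun T >-> (R * R)%type} := mfun_Sub (mem_set mYZ).
pose H (z : R * R) : \bar R := (z.1 * z.2)%:E.
have mH : measurable_fun setT H by apply/measurable_EFinP; exact: measurable_funM.
have lawYZ (A : set (R * R)) : measurable A ->
  distribution P YZm A = (distribution P Ym \x distribution P Zm)%E A.
  exact: distribution_pair_indep.
have iH : (distribution P YZm).-integrable setT H.
  by apply: integrable_pushforward => //; exact: integrable_indepM.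
have ipH : (distribution P Ym \x distribution P Zm)%E.-integrable setT H.
  move/integrableP: iH => [_ iH]; apply/integrableP; split => //.
  by rewrite -(eq_measure_integral _ (fun A mA _ => lawYZ A mA)).
have fZ : (\int[P]_w (Z w)%:E)%E \is a fin_num by exact: integrable_fin_num iZ.
have fY : (\int[P]_w (Y w)%:E)%E \is a fin_num by exact: integrable_fin_num iY.
rewrite /Rintegral -fineM//; congr fine.
have -> : (\int[P]_w (Y w * Z w)%:E = \int[distribution P YZm]_z H z)%E.
  by rewrite integral_pushforward//; exact: integrable_indepM.
rewrite (eq_measure_integral _ (fun A mA _ => lawYZ A mA)).
rewrite -integral12_prod_meas1//.
have FE y : fubini_F (distribution P Zm) H y = (y%:E * \int[P]_w (Z w)%:E)%E.
  rewrite /fubini_F /H /= (eq_integral (fun z => y%:E * z%:E)%E)//.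
  rewrite integralZl//; last by apply: integrable_pushforward.
  by rewrite integral_pushforward// preimage_setT.
rewrite (eq_integral (fun y : R => (y%:E * \int[P]_w (Z w)%:E)%E))//.
rewrite /= -[in LHS](fineK fZ) integralZr//; last exact: integrable_pushforward.
by rewrite integral_pushforward// preimage_setT fineK.
Qed.

End independent_product.

Section mutual_independence.
Context d (T : measurableType d) (R : realType) (P : probability T R) (n : nat).
Variable Y : 'I_n -> T -> R.
Hypothesis mY : forall i, measurable_fun setT (Y i).
Hypothesis indY : mutually_independent P Y.

Lemma mutually_independent_comp (g : 'I_n -> R -> R) :
  (forall i, measurable_fun setT (g i)) ->
  mutually_independent P (fun i w => g i (Y i w)).
Proof.
move=> mg B mB; have mgB i : measurable (g i @^-1` B i).
  by rewrite -[_ @^-1` _]setTI; exact: mg.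
exact: (indY mgB).
Qed.

(** A pi-system generating the sigma-algebra of the [Y k] with [k != i]. Sums and products of the
    other variables are then treated alike, as functions measurable for it. *)
Definition others_rect (i : 'I_n) : set (set T) :=
  [set D | exists2 B : 'I_n -> set R, (forall k, measurable (B k)) &
    D = \bigcap_(k in [set k | k != i]) (Y k @^-1` B k)].

Let others_rect_measurable i : others_rect i `<=` measurable.
Proof.
move=> _ [B mB ->]; apply: fin_bigcap_measurable; first exact: finite_finset.
by move=> k _; rewrite -[_ @^-1` _]setTI; exact: mY.
Qed.

Let others_rectI i : setI_closed (others_rect i).
Proof.
move=> _ _ [B mB ->] [C mC ->].
exists (fun k => B k `&` C k); first by move=> k; exact: measurableI.
by rewrite -bigcapI.
Qed.

Let others_rectT i : others_rect i setT.
Proof.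
exists (fun=> setT) => //.
by apply/esym; rewrite -subTset => w _ k _; exact: I.
Qed.

Lemma others_rect_indep i (A : set R) (D : set T) : measurable A ->
  others_rect i D -> P (Y i @^-1` A `&` D) = (P (Y i @^-1` A) * P D)%E.
Proof.
move=> mA [B mB ->].
(* Used twice: with [A' = A], and with [A' = setT], which identifies the product as [P D]. *)
have E A' : measurable A' ->
    P (Y i @^-1` A' `&` \bigcap_(k in [set k | k != i]) (Y k @^-1` B k)) =
    (P (Y i @^-1` A') * \prod_(k < n | k != i) P (Y k @^-1` B k))%E.
  move=> mA'; have := indY (B := fun k => if k == i then A' else B k).
  rewrite (bigD1 i)//= eqxx.
  under eq_bigr do rewrite ifN//.
  move=> <-; last by move=> k; case: ifP.
    congr (P _); apply/seteqP; split => [w [Aw Bw] k _/=|w /= H].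
      by case: eqP => [->//|/eqP ki]; exact: Bw.
    split; first by have := H i I; rewrite eqxx.
    by move=> k /= ki; have := H k I; rewrite (negbTE ki).
rewrite E//; congr (_ * _)%E.
by have := E _ measurableT; rewrite preimage_setT setTI probability_setT mul1e.
Qed.

(** As functions of [D], both sides are finite measures ([P] restricted to the event, and [P] scaled
    by its probability) that agree on the generating pi-system. *)
Lemma others_sigma_indep i (A : set R) (D : set T) : measurable A ->
  <<s others_rect i >> D -> P (Y i @^-1` A `&` D) = (P (Y i @^-1` A) * P D)%E.
Proof.
move=> mA sD.
have mYA : measurable (Y i @^-1` A) by rewrite -[_ @^-1` _]setTI; exact: mY.
have fA : P (Y i @^-1` A) \is a fin_num by exact: fin_num_measure.
have pA : 0 <= fine (P (Y i @^-1` A)) by exact: fine_ge0.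
pose m2 : {measure set T -> \bar R} := mscale (NngNum pA) P.
pose m1 : {measure set T -> \bar R} := mrestr P mYA.
suff : m1 D = m2 D by rewrite /m1 /m2 /= /mrestr /mscale /= fineK// setIC.
apply: (@g_sigma_algebra_measure_unique _ _ _ (others_rect i)
  (@others_rect_measurable i) (fun=> setT)) => //.
- by apply: bigcup_const; exists 0%N.
- move=> E HE; rewrite /m1 /m2 /= /mrestr /mscale /= fineK// setIC.
  exact: others_rect_indep.
- by move=> k; rewrite /m1 /= /mrestr setTI ltey_eq fA.
Qed.

Let measurable_others i k : k != i ->
  measurable_fun (setT : set (g_sigma_algebraType (others_rect i))) (Y k).
Proof.
move=> ki _ A mA; rewrite setTI; apply: sub_sigma_algebra.
exists (fun j => if j == k then A else setT); first by move=> j; case: ifP.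
apply/seteqP; split => [w Aw j _ /=|w /= H]; first by case: eqP => // ->.
by have := H k ki; rewrite eqxx.
Qed.

Lemma others_indep i (Z : T -> R) (A B : set R) :
  measurable_fun (setT : set (g_sigma_algebraType (others_rect i))) Z ->
  measurable A -> measurable B ->
  P (Y i @^-1` A `&` Z @^-1` B) = (P (Y i @^-1` A) * P (Z @^-1` B))%E.
Proof.
move=> mZ mA mB; apply: others_sigma_indep => //.
by have := mZ measurableT _ mB; rewrite setTI.
Qed.

Lemma sum_others_indep i (c : R) (A B : set R) :
  measurable A -> measurable B ->
  let Z w := \sum_(k < n | k != i) Y k w + c in
  P (Y i @^-1` A `&` Z @^-1` B) = (P (Y i @^-1` A) * P (Z @^-1` B))%E.
Proof.
move=> mA mB; apply: others_indep => //; apply: measurable_funD => //.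
under eq_fun do rewrite big_mkcond.
apply: measurable_sum => k; have [->|ki] := eqVneq k i; first exact: measurable_cst.
exact: measurable_others.
Qed.

Lemma prod_others_indep i (S : pred 'I_n) (A B : set R) : ~~ S i ->
  measurable A -> measurable B ->
  let Z w := \prod_(k < n | S k) Y k w in
  P (Y i @^-1` A `&` Z @^-1` B) = (P (Y i @^-1` A) * P (Z @^-1` B))%E.
Proof.
move=> Si mA mB; apply: others_indep => //.
under eq_fun do rewrite big_mkcond.
apply: measurable_prod => k _; have [Sk|_] := boolP (S k); last exact: measurable_cst.
by apply: measurable_others; apply/eqP => ki; move: Si; rewrite -ki Sk.
Qed.

End mutual_independence.

Lemma Rintegral_prod_indep d (T : measurableType d) (R : realType)
    (P : probability T R) n (Y : 'I_n -> T -> R) :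
  mutually_independent P Y ->
  (forall i, P.-integrable setT (EFin \o Y i)) ->
  P.-integrable setT (EFin \o (fun w => \prod_(i < n) Y i w)) /\
  \int[P]_w (\prod_(i < n) Y i w) = \prod_(i < n) \int[P]_w Y i w.
Proof.
move=> indY iY.
have mY i : measurable_fun setT (Y i).
  by apply/measurable_EFinP; exact: (measurable_int P).
(* Generalized to duplicate-free lists: the head must not occur in the tail if it is to be
   independent of the tail's product. *)
suff H (s : seq 'I_n) : uniq s ->
    P.-integrable setT (EFin \o (fun w => \prod_(i <- s) Y i w)) /\
    \int[P]_w (\prod_(i <- s) Y i w) = \prod_(i <- s) \int[P]_w Y i w.
  exact/H/index_enum_uniq.
elim: s => [_|i s IH] /=.
  have -> : (fun w => \prod_(i <- [::]) Y i w) = cst 1.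
    by apply/funext => w; rewrite big_nil.
  rewrite big_nil; split; first exact: finite_measure_integrable_cst.
  by rewrite Rintegral_cst//= probability_setT mul1r.
move=> /andP[si us]; have [is_ Es] := IH us.
have bigE w : \prod_(k <- i :: s) Y k w = Y i w * \prod_(k <- s) Y k w.
  by rewrite big_cons.
pose Z w : R := \prod_(k <- s) Y k w.
have indi A B : measurable A -> measurable B ->
    P (Y i @^-1` A `&` Z @^-1` B) = (P (Y i @^-1` A) * P (Z @^-1` B))%E.
  move=> mA mB; have := prod_others_indep mY indY (S := mem s) si mA mB.
  suff -> : (fun w => \prod_(k < n | mem s k) Y k w) = Z by [].
  by apply/funext => w; rewrite /Z big_uniq.
have -> : (fun w => \prod_(k <- i :: s) Y k w) =
    (fun w => Y i w * \prod_(k <- s) Y k w) by exact/funext.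
rewrite big_cons -Es; split; first exact: integrable_indepM.
exact: integral_indepM.
Qed.

(** * Change of measure *)

Section change_of_measure.
Context d (T : measurableType d) (R : realType) (P : probability T R).
Variable D : T -> R.

(** The proofs travel with the term, so that the measure and probability structures declared below
    can be inferred from [tilt mD D0 D1] alone. *)
Definition tilt (mD : measurable_fun setT D) (D0 : forall w, 0 <= D w)
    (D1 : (\int[P]_w (D w)%:E = 1)%E) (A : set T) : \bar R :=
  (\int[P]_(w in A) (D w)%:E)%E.

Hypotheses (mD : measurable_fun setT D) (D0 : forall w, 0 <= D w)
  (D1 : (\int[P]_w (D w)%:E = 1)%E).

Let mDE : measurable_fun setT (EFin \o D).
Proof. exact/measurable_EFinP. Qed.

Let tilt0 : tilt mD D0 D1 set0 = 0%E.
Proof. exact: integral_set0. Qed.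

Let tilt_ge0 A : (0 <= tilt mD D0 D1 A)%E.
Proof. by apply: integral_ge0 => w _; rewrite lee_fin. Qed.

Let tilt_sigma_additive : semi_sigma_additive (tilt mD D0 D1).
Proof.
move=> F mF tF mUF; rewrite /tilt ge0_integral_bigcup//.
- apply: is_cvg_ereal_nneg_natsum_cond => k _ _.
  by apply: integral_ge0 => w _; rewrite lee_fin.
- exact: measurable_funTS.
- by move=> w _; rewrite lee_fin.
Qed.

HB.instance Definition _ := isMeasure.Build _ _ _
  (tilt mD D0 D1) tilt0 tilt_ge0 tilt_sigma_additive.

HB.instance Definition _ :=
  @Measure_isProbability.Build _ _ R (tilt mD D0 D1) D1.

Notation Q := (tilt mD D0 D1).

Import HBNNSimple.

(** On the indicator of a level set this is the definition of [tilt]; linearity gives simple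
    functions, and monotone convergence on both sides gives the rest. *)
Lemma ge0_integral_tilt (f : T -> \bar R) : measurable_fun setT f ->
  (forall w, 0 <= f w)%E ->
  (\int[Q]_w f w = \int[P]_w (f w * (D w)%:E))%E.
Proof.
move=> mf f0; pose f_ := nnsfun_approx measurableT mf.
transitivity (limn (fun n => \int[Q]_w (f_ n w)%:E))%E.
  rewrite -monotone_convergence//.
  - apply: eq_integral => w _; apply/esym/cvg_lim => //.
    exact: cvg_nnsfun_approx.
  - by move=> n; exact/measurable_EFinP/measurable_funP.
  - by move=> n w _; rewrite lee_fin.
  - by move=> w _ m n mn; rewrite lee_fin; exact/lefP/nd_nnsfun_approx.
rewrite [X in limn X](_ : _ =
    (fun n => \int[P]_w ((f_ n w)%:E * (D w)%:E)))%E.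
  rewrite -monotone_convergence//; last 3 first.
  - by move=> n; apply: emeasurable_funM => //; exact/measurable_EFinP/measurable_funP.
  - by move=> n w _; rewrite mule_ge0 ?lee_fin.
  - move=> w _ m n mn; rewrite lee_wpmul2r ?lee_fin//.
    exact/lefP/nd_nnsfun_approx.
  apply: eq_integral => w _; apply/cvg_lim => //; apply: cvgeZr => //.
  exact: cvg_nnsfun_approx.
apply/funext => n.
have mfn r : measurable (f_ n @^-1` [set r]) by [].
transitivity (\sum_(k \in range (f_ n)) k%:E * Q (f_ n @^-1` [set k]))%E.
  by rewrite integralT_nnsfun sintegralE.
under [RHS]eq_integral => w _.
  rewrite fimfunE -fsumEFin// ge0_mule_fsuml; last first.
    by move=> r; exact: nnfun_muleindic_ge0.
  over.
rewrite ge0_integral_fsum//; last 2 first.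
- by move=> r; apply: emeasurable_funM => //; exact/measurable_EFinP/measurable_funM.
- move=> r w _; apply: mule_ge0; first exact: nnfun_muleindic_ge0.
  by rewrite lee_fin.
apply: eq_fsbigr => r /[!inE] -[w _ <-].
under [RHS]eq_integral do rewrite EFinM -muleA.
rewrite ge0_integralZl//; last 3 first.
- by apply: emeasurable_funM => //; exact/measurable_EFinP.
- by move=> v _; rewrite -EFinM lee_fin mulr_ge0.
- by rewrite lee_fin.
congr (_ * _)%E; rewrite /= /tilt integral_mkcond.
apply: eq_integral => v _.
by rewrite patchE -EFinM indicE; case: ifP => _; rewrite ?mul1r ?mul0r.
Qed.

Lemma integrable_tilt (f : T -> R) : measurable_fun setT f ->
  P.-integrable setT (EFin \o (fun w => f w * D w)) ->
  Q.-integrable setT (EFin \o f).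
Proof.
move=> mf /integrableP[_ ifD]; apply/integrableP; split.
  exact/measurable_EFinP.
rewrite ge0_integral_tilt//; last by apply/measurable_EFinP; exact: measurableT_comp.
apply: le_lt_trans ifD; rewrite le_eqVlt; apply/orP; left; apply/eqP.
by apply: eq_integral => w _ /=; rewrite normrM (ger0_norm (D0 w)).
Qed.

Lemma Rintegral_tilt (f : T -> R) : measurable_fun setT f ->
  P.-integrable setT (EFin \o (fun w => f w * D w)) ->
  \int[Q]_w f w = \int[P]_w (f w * D w).
Proof.
move=> mf ifD; congr fine; rewrite integralE [RHS]integralE.
have mE : measurable_fun setT (EFin \o f) by exact/measurable_EFinP.
rewrite !ge0_integral_tilt//; last 2 first.
- exact: measurable_funeneg.
- exact: measurable_funepos.
congr (_ - _)%E; apply: eq_integral => w _.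
- by rewrite !funeposE /= -!EFin_max -EFinM maxr_pMl ?mul0r.
- by rewrite !funenegE /= -!EFin_max -EFinM maxr_pMl ?mul0r// mulNr.
Qed.

End change_of_measure.

(** * Expectations and concentration *)

Lemma measurable_ler_ind d (T : measurableType d) (R : realType)
    (f g : T -> R) :
  measurable_fun setT f -> measurable_fun setT g ->
  measurable_fun setT (fun w => (f w <= g w)%R%:R : R).
Proof.
move=> mf mg.
have -> : (fun w => (f w <= g w)%R%:R : R) =
    (fun w => if f w <= g w then 1 else 0).
  by apply/funext => w; case: (f w <= g w).
by apply: measurable_fun_ifT => //; exact: measurable_fun_ler.
Qed.

Section expectation_calculus.
Context d (T : measurableType d) (R : realType) (Q : probability T R).
Implicit Types f g : T -> R.

Local Notation L1 f := (Q.-integrable setT (EFin \o f)).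

Lemma L1_measurable f : L1 f -> measurable_fun setT f.
Proof. by move=> /measurable_int/measurable_EFinP. Qed.

Lemma L1_le f g : measurable_fun setT f -> (forall w, `|f w| <= g w) ->
  L1 g -> L1 f.
Proof.
move=> mf fg; apply: le_integrable => //; first exact/measurable_EFinP.
by move=> w _; rewrite /= lee_fin (le_trans (fg w))// ler_norm.
Qed.

Lemma L1_cst (k : R) : L1 (fun=> k).
Proof. exact: finite_measure_integrable_cst. Qed.

Lemma L1_bounded f (k : R) : measurable_fun setT f ->
  (forall w, `|f w| <= k) -> L1 f.
Proof. by move=> mf fk; apply: (L1_le mf fk); exact: L1_cst. Qed.

Lemma L1D f g : L1 f -> L1 g -> L1 (fun w => f w + g w).
Proof.
move=> lf lg; apply: eq_integrable (integrableD measurableT lf lg) => //.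
Qed.

Lemma L1B f g : L1 f -> L1 g -> L1 (fun w => f w - g w).
Proof.
move=> lf lg; apply: eq_integrable (integrableB measurableT lf lg) => //.
Qed.

Lemma L1Zl (k : R) f : L1 f -> L1 (fun w => k * f w).
Proof.
move=> lf; apply: eq_integrable (integrableZl measurableT k lf) => //.
Qed.

Lemma L1_sum (I : Type) (s : seq I) (P : pred I) (F : I -> T -> R) :
  (forall i, P i -> L1 (F i)) -> L1 (fun w => \sum_(i <- s | P i) F i w).
Proof.
move=> lF; apply: eq_integrable (integrable_sum measurableT s lF) => //.
by move=> w _ /=; rewrite sumEFin.
Qed.

Lemma Rintegral_sum (I : Type) (s : seq I) (P : pred I) (F : I -> T -> R) :
  (forall i, P i -> L1 (F i)) ->
  \int[Q]_w (\sum_(i <- s | P i) F i w) = \sum_(i <- s | P i) \int[Q]_w F i w.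
Proof.
move=> lF; elim: s => [|i s IH].
  under eq_Rintegral do rewrite big_nil.
  by rewrite big_nil Rintegral_cst// mul0r.
under eq_Rintegral do rewrite big_cons; rewrite big_cons.
case: ifPn => // Pi; rewrite RintegralD//; first by rewrite IH.
  exact: lF.
exact: L1_sum.
Qed.

Lemma expectation_cst_real (k : R) : \int[Q]_w k = k.
Proof. by rewrite Rintegral_cst//= probability_setT mulr1. Qed.

Lemma Rintegral_le f g : L1 f -> L1 g -> (forall w, f w <= g w) ->
  \int[Q]_w f w <= \int[Q]_w g w.
Proof. by move=> lf lg fg; apply: le_Rintegral. Qed.

Lemma norm_Rintegral_le f g : L1 f -> L1 g -> (forall w, `|f w| <= g w) ->
  `|\int[Q]_w f w| <= \int[Q]_w g w.
Proof.
move=> lf lg fg; apply: (le_trans (le_normr_Rintegral measurableT lf)).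
by apply: Rintegral_le => //; exact: integrable_norm.
Qed.

Lemma norm_Rintegral_le_cst f (k : R) : L1 f -> (forall w, `|f w| <= k) ->
  `|\int[Q]_w f w| <= k.
Proof.
move=> lf fk; rewrite -[leRHS](expectation_cst_real k).
by apply: norm_Rintegral_le => //; exact: L1_cst.
Qed.

Lemma L1_pow_le f (j k : nat) : (j <= k)%N -> measurable_fun setT f ->
  L1 (fun w => `|f w| ^+ k) -> L1 (fun w => `|f w| ^+ j).
Proof.
move=> jk mf lf; apply: (@L1_le _ (fun w => 1 + `|f w| ^+ k)).
- by apply: measurable_funX; exact: measurableT_comp.
- move=> w; rewrite normrX normr_id.
  have [f1|/ltW f1] := leP `|f w| 1.
    by rewrite (le_trans (exprn_ile1 _ (normr_ge0 _) f1))// lerDl exprn_ge0.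
  by rewrite (le_trans (ler_weXn2l f1 jk))// lerDr.
- by apply: L1D => //; exact: L1_cst.
Qed.

(** Once [Y] is frozen by Tonelli, the event has the constant radius [|Y w|] and the hypothesis on
    [Z] applies. This is how a concentration bound gets used at a random radius. *)
Lemma expectation_joint_le (Y Z : T -> R) (F kappa : R -> R) :
  measurable_fun setT Y -> measurable_fun setT Z ->
  (forall A B : set R, measurable A -> measurable B ->
    Q (Y @^-1` A `&` Z @^-1` B) = (Q (Y @^-1` A) * Q (Z @^-1` B))%E) ->
  measurable_fun setT F -> (forall y, 0 <= F y) ->
  (forall r, 0 <= r -> \int[Q]_w (`|Z w| <= r)%R%:R <= kappa r) ->
  L1 (fun w => F (Y w)) -> L1 (fun w => F (Y w) * kappa `|Y w|) ->
  \int[Q]_w (F (Y w) * (`|Z w| <= `|Y w|)%R%:R) <=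
  \int[Q]_w (F (Y w) * kappa `|Y w|).
Proof.
move=> mY mZ indYZ mF F0 Zk lF lFk.
pose H (z : R * R) : \bar R := (F z.1 * (`|z.2| <= `|z.1|)%R%:R)%:E.
have mb : measurable_fun setT (fun z : R * R => (`|z.2| <= `|z.1|)%R%:R : R).
  by apply: measurable_ler_ind; exact: measurableT_comp.
have mH : measurable_fun setT H.
  by apply/measurable_EFinP/measurable_funM => //; exact: measurableT_comp.
have H0 z : (0 <= H z)%E by rewrite lee_fin mulr_ge0.
have mZr (r : R) : measurable_fun setT (fun w => (`|Z w| <= r)%R%:R : R).
  by apply: measurable_ler_ind; [exact: measurableT_comp|exact: measurable_cst].
have lZr (r : R) : L1 (fun w => (`|Z w| <= r)%R%:R : R).
  by apply: (@L1_bounded _ 1) => // w; rewrite normr_nat lern1 leq_b1.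
have inner w : (\int[Q]_w' H (Y w, Z w') =
    (F (Y w) * \int[Q]_w' (`|Z w'| <= `|Y w|)%R%:R)%:E)%E.
  rewrite /H /= EFinM fineK; last exact: integrable_fin_num (lZr _).
  rewrite -integralZl//; last exact: lZr.
rewrite /Rintegral fine_le//.
- apply: integrable_fin_num => //; apply: (L1_le _ _ lF).
  + apply: measurable_funM; first exact: L1_measurable lF.
    by apply: measurable_ler_ind; exact: measurableT_comp.
  + move=> w; rewrite normrM normr_nat (ger0_norm (F0 _)) ler_piMr//.
    by rewrite lern1 leq_b1.
- exact: integrable_fin_num.
rewrite -[leLHS]/(\int[Q]_w H (Y w, Z w))%E (ge0_integral_indep mY mZ indYZ mH H0).
have mG : measurable_fun setT (fun p : R * T => H (p.1, Z p.2)).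
  apply: measurableT_comp => //; apply/measurable_fun_pairP; split.
    exact: measurable_fst.
  exact: (measurableT_comp mZ measurable_snd).
have mI : measurable_fun setT (fun w => \int[Q]_w' H (Y w, Z w'))%E.
  have := measurable_fun_fubini_tonelli_F (m2 := Q) _ mG (fun p => H0 _).
  by move=> mF'; exact: (measurableT_comp mF' mY).
apply: ge0_le_integral => //.
- by move=> w _; exact: integral_ge0.
- exact: (measurable_int Q).
- move=> w _; rewrite inner lee_fin ler_wpM2l//; exact: Zk.
Qed.

End expectation_calculus.

Section independent_sums.
Context d (T : measurableType d) (R : realType) (Q : probability T R) (n : nat).
Variable Y : 'I_n -> T -> R.
Hypothesis mY : forall i, measurable_fun setT (Y i).
Hypothesis indY : mutually_independent Q Y.

Local Notation L1 f := (Q.-integrable setT (EFin \o f)).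

Lemma measurable_sum_others (P : pred 'I_n) (c : R) :
  measurable_fun setT (fun w => \sum_(k < n | P k) Y k w + c).
Proof.
apply: measurable_funD => //; under eq_fun do rewrite big_mkcond.
by apply: measurable_sum => k; case: (P k).
Qed.

Lemma expectation_others (i : 'I_n) (c : R) (F G : R -> R) :
  let V w := \sum_(k < n | k != i) Y k w + c in
  measurable_fun setT F -> measurable_fun setT G ->
  L1 (fun w => F (Y i w)) -> L1 (fun w => G (V w)) ->
  L1 (fun w => F (Y i w) * G (V w)) /\
  \int[Q]_w (F (Y i w) * G (V w)) =
    \int[Q]_w F (Y i w) * \int[Q]_w G (V w).
Proof.
move=> V mF mG lF lG.
have ind (A B : set R) : measurable A -> measurable B ->
    Q ((fun w => F (Y i w)) @^-1` A `&` (fun w => G (V w)) @^-1` B) =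
    (Q ((fun w => F (Y i w)) @^-1` A) * Q ((fun w => G (V w)) @^-1` B))%E.
  move=> mA mB; apply: (@sum_others_indep _ _ _ _ _ _ mY indY i c (F @^-1` A) (G @^-1` B)).
    by rewrite -[X in measurable X]setTI; exact: mF.
  by rewrite -[X in measurable X]setTI; exact: mG.
by split; [exact: integrable_indepM|exact: integral_indepM].
Qed.

(** Only one factor of the square is expanded: each [Y i] meets itself and the sum of the others,
    which is independent of it, so the cross term vanishes without a double sum. *)
Lemma expectation_sum_sqr :
  (forall i, L1 (Y i)) -> (forall i, L1 (fun w => Y i w ^+ 2)) ->
  (forall i, \int[Q]_w Y i w = 0) ->
  L1 (fun w => (\sum_(i < n) Y i w) ^+ 2) /\
  \int[Q]_w (\sum_(i < n) Y i w) ^+ 2 = \sum_(i < n) \int[Q]_w Y i w ^+ 2.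
Proof.
move=> lY lY2 Y0.
pose V i w := \sum_(k < n | k != i) Y k w + 0.
have lV i : L1 (V i) by apply: L1D; [exact: L1_sum|exact: L1_cst].
have YV i := expectation_others (i := i) (c := 0) (measurable_id (D := setT))
  (measurable_id (D := setT)) (lY i) (lV i).
have E w : (\sum_(i < n) Y i w) ^+ 2 = \sum_(i < n) (Y i w ^+ 2 + Y i w * V i w).
  rewrite expr2 mulr_suml; apply: eq_bigr => i _.
  by rewrite /V addr0 [in LHS](bigD1 i)//= mulrDr expr2.
have lE i : L1 (fun w => Y i w ^+ 2 + Y i w * V i w).
  by apply: L1D => //; case: (YV i).
rewrite (_ : (fun w => _ ^+ 2) = fun w => \sum_(i < n) (Y i w ^+ 2 + Y i w * V i w));
  last exact/funext.
split; first exact: L1_sum.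
rewrite Rintegral_sum//; apply: eq_bigr => i _.
have [lYV EYV] := YV i.
by rewrite RintegralD// EYV Y0 mul0r addr0.
Qed.

End independent_sums.

(** The arithmetic-geometric inequality with a free scale [b]. It replaces Cauchy-Schwarz wherever a
    first absolute moment is bounded by a second moment. *)
Lemma abs_le_sqr (R : realFieldType) (a b : R) : 0 < b ->
  `|a| <= b / 2 + a ^+ 2 / (2 * b).
Proof.
move=> b0; rewrite -subr_ge0.
have -> : b / 2 + a ^+ 2 / (2 * b) - `|a| = (`|a| - b) ^+ 2 / (2 * b).
  rewrite -(real_normK (num_real a)); field; rewrite gt_eqF//.
by rewrite divr_ge0 ?sqr_ge0// mulr_ge0// ltW.
Qed.

(** * Concentration of sums of independent variables *)

Section clip.
Context {R : realFieldType}.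
Implicit Types m v t g : R.

Definition clip m v : R := Num.max (- m) (Num.min v m).

Lemma norm_clip m v : 0 <= m -> `|clip m v| <= m.
Proof.
move=> m0; rewrite /clip ler_norml le_max lexx/= ge_max ge_min lexx orbT andbT.
by rewrite (le_trans _ m0)// oppr_le0.
Qed.

Lemma clip_id m v : `|v| <= m -> clip m v = v.
Proof.
by rewrite ler_norml /clip => /andP[v0 v1]; rewrite min_l// max_r.
Qed.

Lemma clip_homo m u v : u <= v -> clip m u <= clip m v.
Proof.
move=> uv; rewrite /clip ge_max le_max lexx/= le_max; apply/orP; right.
by rewrite le_min !ge_min uv lexx orbT.
Qed.

Lemma clip_diff_ge0 m v t : 0 <= t * (clip m v - clip m (v - t)).
Proof.
have [t0|t0] := leP 0 t.
  by rewrite mulr_ge0// subr_ge0 clip_homo// gerBl.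
by rewrite mulr_le0 ?(ltW t0)// subr_le0 clip_homo// lerBrDr gerDl ltW.
Qed.

(** Clipping at [r + g] leaves a margin [g] on both sides of [[-r, r]], so from [v] the clipped
    identity still follows a displacement up to length [g]. *)
Lemma clip_diff_ge r g v t : 0 < g -> `|v| <= r ->
  `|t| * Num.min `|t| g <= t * (clip (r + g) v - clip (r + g) (v - t)).
Proof.
move=> g0 vr; rewrite clip_id; last by rewrite (le_trans vr)// lerDl ltW.
have [t0|t0] := leP 0 t.
  rewrite ger0_norm// ler_wpM2l//; have [tg|gt] := leP t g.
    by rewrite clip_id ?opprB ?[_ + (t - v)]addrC ?subrK// (le_trans (ler_normB _ _))//
      lerD// ger0_norm.
  apply: (@le_trans _ _ (v - clip (r + g) (v - g))).
    rewrite clip_id; first lra.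
    by rewrite (le_trans (ler_normB _ _))// lerD// gtr0_norm.
  by rewrite lerB// clip_homo// lerB// ltW.
rewrite ltr0_norm// -[leRHS]mulrNN ler_wpM2l ?oppr_ge0 ?(ltW t0)// opprB.
have [tg|gt] := leP (- t) g.
  rewrite clip_id; first lra.
  by rewrite (le_trans (ler_normB _ _))// lerD// ltr0_norm.
apply: (@le_trans _ _ (clip (r + g) (v + g) - v)).
  rewrite clip_id; first lra.
  by rewrite (le_trans (ler_normD _ _))// lerD// gtr0_norm.
rewrite lerB// clip_homo//; lra.
Qed.

End clip.

Section concentration.
Context d (T : measurableType d) (R : realType) (Q : probability T R) (n : nat).
Variable Y : 'I_n -> T -> R.
Hypothesis mY : forall i, measurable_fun setT (Y i).
Hypothesis indY : mutually_independent Q Y.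

Local Notation L1 f := (Q.-integrable setT (EFin \o f)).

Hypothesis lY3 : forall i, L1 (fun w => `|Y i w| ^+ 3).

Lemma L1_of_cube i : L1 (Y i).
Proof.
apply: (@L1_le _ _ _ _ _ (fun w => `|Y i w| ^+ 1)) => //.
exact: (L1_pow_le (k := 3)).
Qed.

Lemma L1_sqr_of_cube i : L1 (fun w => Y i w ^+ 2).
Proof.
have := @L1_pow_le _ _ _ Q (Y i) 2 3 isT (mY i) (lY3 i).
by under eq_fun do rewrite real_normK ?num_real//.
Qed.

Hypothesis Y0 : forall i, \int[Q]_w Y i w = 0.

Variables (c r g : R).
Hypotheses (g0 : 0 < g) (r0 : 0 <= r).
Hypothesis v_ge : 2^-1 <= \sum_(i < n) \int[Q]_w Y i w ^+ 2.
Hypothesis v_le : \sum_(i < n) \int[Q]_w Y i w ^+ 2 <= 5 / 4.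
Hypothesis cube_le : \sum_(i < n) \int[Q]_w `|Y i w| ^+ 3 <= g.

Let U w := \sum_(i < n) Y i w.
Let V w := U w + c.
(** The gain that [clip_diff_ge] gives for the increment [Y i]. It is quadratic near [0] but at most
    [g * |Y i|], so its variance is controlled by second moments alone. *)
Let gam w i := `|Y i w| * Num.min `|Y i w| g.
Let G w := \sum_(i < n) gam w i.
Let p := \int[Q]_w (`|V w| <= r)%R%:R.

Let mU : measurable_fun setT U.
Proof. exact: measurable_sum. Qed.

Let mV : measurable_fun setT V.
Proof. exact: measurable_funD. Qed.

Let mnY i : measurable_fun setT (fun w => `|Y i w|).
Proof. exact: measurableT_comp. Qed.

Let mgam i : measurable_fun setT (gam ^~ i).
Proof. by apply: measurable_funM => //; exact: measurable_minr. Qed.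

Let gam_ge0 w i : 0 <= gam w i.
Proof. by rewrite mulr_ge0// le_min normr_ge0 ltW. Qed.

Let gam_le w i : gam w i <= g * `|Y i w|.
Proof. by rewrite /gam mulrC ler_wpM2r// ge_min lexx orbT. Qed.

Let lgam i : L1 (gam ^~ i).
Proof.
apply: (@L1_le _ _ _ _ _ (fun w => g * `|Y i w|)) => //.
  by move=> w; rewrite ger0_norm.
by apply: L1Zl; exact: integrable_norm (L1_of_cube i).
Qed.

Let gam_sqr_le w i : gam w i ^+ 2 <= g ^+ 2 * Y i w ^+ 2.
Proof.
rewrite -[Y i w ^+ 2]real_normK ?num_real// -exprMn.
by rewrite ler_sqr ?nnegrE// mulr_ge0// ltW.
Qed.

Let lgam2 i : L1 (fun w => gam w i ^+ 2).
Proof.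
apply: (@L1_le _ _ _ _ _ (fun w => g ^+ 2 * Y i w ^+ 2)).
- exact: measurable_funX.
- by move=> w; rewrite ger0_norm ?sqr_ge0.
- by apply: L1Zl; exact: L1_sqr_of_cube.
Qed.

Let mclip : measurable_fun setT (clip (r + g)).
Proof. by apply: measurable_maxr => //; exact: measurable_minr. Qed.

Let rg0 : 0 <= r + g. Proof. by rewrite addr_ge0// ltW. Qed.

Let lclipM i (Z : T -> R) : measurable_fun setT Z ->
  L1 (fun w => Y i w * clip (r + g) (Z w)).
Proof.
move=> mZ; apply: (@L1_le _ _ _ _ _ (fun w => (r + g) * `|Y i w|)).
- by apply: measurable_funM => //; exact: measurableT_comp.
- by move=> w; rewrite normrM mulrC ler_wpM2r// norm_clip.
- by apply: L1Zl; exact: integrable_norm (L1_of_cube i).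
Qed.

Let lind : L1 (fun w => (`|V w| <= r)%R%:R).
Proof.
apply: (@L1_bounded _ _ _ _ _ 1).
  by apply: measurable_ler_ind => //; exact: measurableT_comp.
by move=> w; rewrite normr_nat lern1 leq_b1.
Qed.

Let lUclip : L1 (fun w => U w * clip (r + g) (V w)).
Proof.
under eq_fun do rewrite mulr_suml.
by apply: L1_sum => i _; exact: lclipM.
Qed.

(* [E (Y i * clip (V - Y i)) = 0], so the left side is also the expectation of
   [sum_i Y i * (clip V - clip (V - Y i))], a sum of nonnegative terms. *)
Let Uclip_ge : \int[Q]_w ((`|V w| <= r)%R%:R * G w) <=
  \int[Q]_w (U w * clip (r + g) (V w)).
Proof.
pose W i w := \sum_(k < n | k != i) Y k w + c.
have VW i w : V w - Y i w = W i w by rewrite /V /U (bigD1 i)//= /W; ring.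
have mW i : measurable_fun setT (W i) by exact: measurable_sum_others.
have EW i : \int[Q]_w (Y i w * clip (r + g) (W i w)) = 0.
  have lc : L1 (fun w => clip (r + g) (W i w)).
    apply: (@L1_bounded _ _ _ _ _ (r + g)).
      exact: measurableT_comp.
    by move=> w; exact: norm_clip.
  have [_ ->] := expectation_others mY indY (F := id) (measurable_id (D := setT))
    mclip (L1_of_cube i) lc.
  by rewrite Y0 mul0r.
have -> : \int[Q]_w (U w * clip (r + g) (V w)) =
    \int[Q]_w (\sum_(i < n) Y i w * (clip (r + g) (V w) - clip (r + g) (W i w))).
  under eq_Rintegral do rewrite mulr_suml.
  rewrite !Rintegral_sum; last 2 first.
  - move=> i _; under eq_fun do rewrite mulrBr.
    by apply: L1B; exact: lclipM.
  - by move=> i _; exact: lclipM.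
  apply: eq_bigr => i _; under [RHS]eq_Rintegral do rewrite mulrBr.
  rewrite RintegralB//; [|exact: lclipM|exact: lclipM].
  by rewrite EW subr0.
apply: Rintegral_le.
- apply: (@L1_le _ _ _ _ _ G).
  + apply: measurable_funM; first exact: L1_measurable lind.
    exact: measurable_sum.
  + move=> w; have G0 : 0 <= G w by exact: sumr_ge0.
    by rewrite normrM normr_nat (ger0_norm G0) ler_piMl// lern1 leq_b1.
  + exact: L1_sum.
- apply: L1_sum => i _; under eq_fun do rewrite mulrBr.
  by apply: L1B; exact: lclipM.
move=> w; case: (boolP (`|V w| <= r)) => Vr.
  rewrite mul1r; apply: ler_sum => i _.
  by rewrite -VW clip_diff_ge.
by rewrite mul0r sumr_ge0// => i _; rewrite -VW clip_diff_ge0.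
Qed.

Let Uclip_le : \int[Q]_w (U w * clip (r + g) (V w)) <= 2 * (r + g).
Proof.
have [lU2 EU2] := expectation_sum_sqr mY indY L1_of_cube L1_sqr_of_cube Y0.
apply: (@le_trans _ _ (\int[Q]_w ((r + g) * (1 / 2 + 2^-1 * U w ^+ 2)))).
  apply: Rintegral_le => //.
    by apply: L1Zl; apply: L1D; [exact: L1_cst|exact: L1Zl].
  move=> w; apply: (le_trans (ler_norm _)); rewrite normrM mulrC.
  have := abs_le_sqr (U w) (@ltr01 R); have := norm_clip (V w) rg0.
  have := normr_ge0 (U w); have := normr_ge0 (clip (r + g) (V w)).
  by nra.
rewrite RintegralZl//; last by apply: L1D; [exact: L1_cst|exact: L1Zl].
rewrite RintegralD//; [|exact: L1_cst|exact: L1Zl].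
rewrite expectation_cst_real RintegralZl// EU2.
rewrite mulrC ler_wpM2r//; move: v_le; set s := \sum_(i < n) _; lra.
Qed.

(** Pointwise [min(a, g) >= a - a^2 / (4 g)], the slack against [g] being the square
    [(a - 2 g)^2 / (4 g)]. The third moments add up to at most [g], so at most [1/4] of the variance
    [1/2] is lost; this is what fixes the margin [g]. *)
Let EG_ge : 4^-1 <= \int[Q]_w G w.
Proof.
rewrite Rintegral_sum//.
apply: (@le_trans _ _ (\sum_(i < n)
  (\int[Q]_w Y i w ^+ 2 - (4 * g)^-1 * \int[Q]_w `|Y i w| ^+ 3))).
  rewrite sumrB -mulr_sumr.
  have : (4 * g)^-1 * \sum_(i < n) \int[Q]_w `|Y i w| ^+ 3 <= 4^-1.
    by rewrite invfM -mulrA ler_piMr// mulrC ler_pdivrMr// mul1r.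
  move: v_ge; set s := \sum_(i < n) \int[Q]_w (Y i w ^+ 2).
  set u := _^-1 * _; lra.
apply: ler_sum => i _.
rewrite -RintegralZl// -RintegralB//; [|exact: L1_sqr_of_cube|exact: L1Zl].
apply: Rintegral_le => //.
  by apply: L1B; [exact: L1_sqr_of_cube|exact: L1Zl].
move=> w; rewrite /gam -[Y i w ^+ 2]real_normK ?num_real//.
set a := `|Y i w|; have a0 : 0 <= a by exact: normr_ge0.
have -> : a ^+ 2 - (4 * g)^-1 * a ^+ 3 = a * (a - a ^+ 2 / (4 * g)) by field; rewrite gt_eqF.
rewrite ler_wpM2l// le_min; apply/andP; split.
  by rewrite gerBl divr_ge0 ?sqr_ge0// mulr_ge0// ltW.
rewrite -subr_ge0.
have -> : g - (a - a ^+ 2 / (4 * g)) = (a - 2 * g) ^+ 2 / (4 * g) by field; rewrite gt_eqF.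
by rewrite divr_ge0 ?sqr_ge0// mulr_ge0// ltW.
Qed.

Let EG := \int[Q]_w G w.

(** [G] is a sum of independent variables whose variances add up to at most [(5/4) g^2], so
    [abs_le_sqr] at scale [g] bounds the mean deviation by [(1/2 + 5/8) g]. *)
Let G_dev : L1 (fun w => `|G w - EG|) /\ \int[Q]_w `|G w - EG| <= 2 * g.
Proof.
pose Z i w := gam w i - \int[Q]_w gam w i.
have mZ i : measurable_fun setT (Z i) by exact: measurable_funB.
have indZ : mutually_independent Q Z.
  apply: (@mutually_independent_comp _ _ _ _ _ _ indY
    (fun i y => `|y| * Num.min `|y| g - \int[Q]_w gam w i)).
  move=> i; apply: measurable_funB => //; apply: measurable_funM => //.
  exact: measurable_minr.
have lZ i : L1 (Z i) by apply: L1B => //; exact: L1_cst.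
have ZE i w : Z i w ^+ 2 = (gam w i ^+ 2 - 2 * (\int[Q]_w gam w i) * gam w i)
    + (\int[Q]_w gam w i) ^+ 2 by rewrite /Z; ring.
have lZ2 i : L1 (fun w => Z i w ^+ 2).
  under eq_fun do rewrite ZE.
  by apply: L1D; [apply: L1B => //; exact: L1Zl|exact: L1_cst].
have Z0 i : \int[Q]_w Z i w = 0.
  by rewrite RintegralB//; [rewrite expectation_cst_real subrr|exact: L1_cst].
have EZ2 i : \int[Q]_w Z i w ^+ 2 <= g ^+ 2 * \int[Q]_w Y i w ^+ 2.
  under eq_Rintegral do rewrite ZE.
  rewrite RintegralD//; [|apply: L1B => //; exact: L1Zl|exact: L1_cst].
  rewrite RintegralB//; last exact: L1Zl.
  rewrite expectation_cst_real RintegralZl//.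
  have : \int[Q]_w gam w i ^+ 2 <= g ^+ 2 * \int[Q]_w Y i w ^+ 2.
    rewrite -RintegralZl//; last exact: L1_sqr_of_cube.
    apply: Rintegral_le => //.
    by apply: L1Zl; exact: L1_sqr_of_cube.
  have := sqr_ge0 (\int[Q]_w gam w i); rewrite expr2.
  set a := \int[Q]_w gam w i; set b := \int[Q]_w _ ^+ 2; set c' := g ^+ 2 * _.
  lra.
have GE w : G w - EG = \sum_(i < n) Z i w.
  by rewrite sumrB /EG /G Rintegral_sum.
have [lZs EZs] := expectation_sum_sqr mZ indZ lZ lZ2 Z0.
have lGd : L1 (fun w => `|G w - EG|).
  by apply: integrable_norm; under eq_fun do rewrite GE; exact: L1_sum.
split => //; apply: (@le_trans _ _
  (\int[Q]_w (g / 2 + (2 * g)^-1 * (\sum_(i < n) Z i w) ^+ 2))).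
  apply: Rintegral_le => //.
    by apply: L1D; [exact: L1_cst|exact: L1Zl].
  by move=> w; rewrite GE (le_trans (abs_le_sqr _ g0))// mulrC [_^-1 * _]mulrC.
rewrite RintegralD//; [|exact: L1_cst|exact: L1Zl].
rewrite expectation_cst_real RintegralZl// EZs.
have : \sum_(i < n) \int[Q]_w Z i w ^+ 2 <= g ^+ 2 * (5 / 4).
  apply: (@le_trans _ _ (\sum_(i < n) g ^+ 2 * \int[Q]_w Y i w ^+ 2)).
    exact: ler_sum.
  by rewrite -mulr_sumr ler_wpM2l ?sqr_ge0.
set s := \sum_(i < n) _ => sle.
have : (2 * g)^-1 * s <= (2 * g)^-1 * (g ^+ 2 * (5 / 4)).
  by rewrite ler_wpM2l// invr_ge0 mulr_ge0// ltW.
have -> : (2 * g)^-1 * (g ^+ 2 * (5 / 4)) = 5 / 8 * g by field; rewrite gt_eqF.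
have aux (a b : R) : 0 < b -> a <= 5 / 8 * b -> b / 2 + a <= 2 * b by lra.
exact: aux.
Qed.

(** [G] depends on the event, so it is first replaced by its mean at the price of its deviation: [p
    / 4 <= p EG <= E(1_{|V| <= r} G) + 2 g <= 2 (r + g) + 2 g]. *)
Lemma concentration : \int[Q]_w (`|\sum_(i < n) Y i w + c| <= r)%R%:R <=
  8 * r + 16 * g.
Proof.
have aux (a b c1 c2 q s t : R) : 4^-1 * q <= a -> a - b <= c1 -> c1 <= c2 ->
  c2 <= 2 * (s + t) -> b <= 2 * t -> q <= 8 * s + 16 * t by lra.
have [lGd EGd] := G_dev.
have H : EG * p - \int[Q]_w `|G w - EG| <= \int[Q]_w ((`|V w| <= r)%R%:R * G w).
  rewrite -RintegralZl// -RintegralB//; last exact: L1Zl.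
  apply: Rintegral_le.
  - by apply: L1B => //; exact: L1Zl.
  - apply: (@L1_le _ _ _ _ _ G).
    + apply: measurable_funM; first exact: L1_measurable lind.
      exact: measurable_sum.
    + move=> w; have G0 : 0 <= G w by exact: sumr_ge0.
      by rewrite normrM normr_nat (ger0_norm G0) ler_piMl// lern1 leq_b1.
    + exact: L1_sum.
  move=> w; have := ler_norm (EG - G w); rewrite distrC.
  have := normr_ge0 (G w - EG).
  by case: (`|V w| <= r); rewrite /= ?mulr1 ?mul1r ?mulr0 ?mul0r; lra.
have p0 : 0 <= p by apply: Rintegral_ge0 => w _.
have := Uclip_ge; have := Uclip_le; have := EG_ge; rewrite -/EG => E4 U1 U2.
have pE : 4^-1 * p <= EG * p by rewrite ler_wpM2r.
exact: aux pE H U2 U1 EGd.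
Qed.

End concentration.

(** * The Mills ratio and Stein's equation *)

Lemma is_derive_mvt (R : realType) (f df : R -> R) (a b : R) : a <= b ->
  (forall c, a <= c <= b -> is_derive c 1 f (df c)) ->
  exists2 c, a <= c <= b & f b - f a = df c * (b - a).
Proof.
move=> ab fdf.
have [x||c cab ->] := @MVT_segment _ f df a b ab.
- by rewrite in_itv/= => /andP[ax xb]; apply: fdf; rewrite !ltW.
- by apply: derivable_within_continuous => x; rewrite in_itv/= => /fdf[].
by exists c => //; move: cab; rewrite in_itv.
Qed.

Section mills_ratio.
Context {R : realType}.
Implicit Types x w : R.

Local Notation c0 := (@normal_peak R 1).

Definition mills w : R := (1 - Phi w) * expR (w ^+ 2 / 2) / c0.

Lemma normal_peak1_gt0 : 0 < c0.
Proof. by apply: normal_peak_gt0; exact: oner_neq0. Qed.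

Lemma normal_pdf01E w : normal_pdf 0 1 w = c0 * expR (- (w ^+ 2 / 2)).
Proof.
rewrite normal_pdfE ?oner_neq0//; congr (_ * expR _).
by rewrite subr0 expr1n mulNr.
Qed.

Lemma is_derive_Phi w : is_derive w 1 (@Phi R) (c0 * expR (- (w ^+ 2 / 2))).
Proof.
have -> : @Phi R = (fun x => \int[lebesgue_measure]_(t in
    [set` Interval -oo%O (BRight x)]) normal_pdf 0 1 t).
  apply/funext => x; rewrite /Phi /normal_prob -[LHS]/(Rintegral _ _ _).
  suff -> : [set y : R | y <= x] = [set` Interval -oo%O (BRight x)] by [].
  by apply/seteqP; split => y /=; rewrite in_itv.
have [] := @continuous_FTC1 R (normal_pdf 0 1) -oo%O w (w + 1).
- by rewrite ltrDl.
- apply: (integrableS measurableT) => //.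
  exact: integrable_normal_pdf.
- by rewrite ltNyr.
- exact/continuous_normal_pdf/oner_neq0.
by move=> dF E; apply: DeriveDef => //; rewrite -derive1E E normal_pdf01E.
Qed.

Let mray w : measurable [set y : R | y <= w].
Proof.
suff -> : [set y : R | y <= w] = [set` `]-oo, w]] by exact: measurable_itv.
by apply/seteqP; split => y /=; rewrite in_itv.
Qed.

Lemma Phi_le1 w : Phi w <= 1.
Proof.
rewrite /Phi -lee_fin fineK.
  by apply: probability_le1; exact: mray.
by apply: fin_num_measure; exact: mray.
Qed.

Lemma Phi_cvg1 : Phi w @[w --> +oo] --> (1 : R).
Proof.
pose N01 : probability (measurableTypeR R) R := normal_prob 0 1.
have mX : @measurable_fun _ _ (measurableTypeR R) R setT idfun.
  exact: measurable_id.
pose X : {RV N01 >-> R} := @mfun_Sub _ _ (measurableTypeR R) R idfun (mem_set mX).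
have -> : @Phi R = fine \o cdf X.
  apply/funext => w; rewrite /Phi /= /cdf /distribution /pushforward /=.
  by rewrite set_itvNyc.
exact/fine_cvg/(cvg_cdfy1 X).
Qed.

(** The density is even. The value gives [mills 0], on which the gluing of the two halves of the
    Stein solution rests. *)
Lemma Phi0 : Phi 0 = 2^-1 :> R.
Proof.
have := integral_normal_pdf (0 : R) 1.
rewrite ge0_symfun_integralT//; last 3 first.
- exact: normal_pdf_ge0.
- exact/continuous_normal_pdf/oner_neq0.
- by move=> w; rewrite /= !normal_pdf01E sqrrN.
set I := (\int[_]_(_ in _) _)%E => I2.
have I0 : normal_prob (0 : R) 1 `]0, +oo[ = I.
  rewrite /normal_prob integral_itv_obnd_cbnd; last first.
    apply: measurable_funTS; apply/measurable_EFinP.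
    exact: measurable_normal_pdf.
  by rewrite /I set_itvcy.
have : normal_prob (0 : R) 1 (~` [set y : R | y <= 0]) = I.
  rewrite -I0; congr (normal_prob _ _ _).
  by apply/seteqP; split => y /=; rewrite in_itv/= andbT ltNge => /negP.
rewrite probability_setC; last exact: mray.
have P0 : normal_prob (0 : R) 1 [set y : R | y <= 0] = (Phi 0)%:E.
  by rewrite fineK//; apply: fin_num_measure; exact: mray.
move=> Ip; have {}Ip : (1 - (Phi 0)%:E)%E = I by rewrite -Ip -P0.
have : (2 * (1 - Phi 0))%:E = 1%:E :> \bar R by rewrite -I2 -Ip.
by move=> [] E; lra.
Qed.

Lemma is_derive_mills w : is_derive w 1 mills (w * mills w - 1).
Proof.
have := normal_peak1_gt0 => c0p.
have dP := is_derive_Phi w.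
suff : is_derive w 1 (fun w => (1 - Phi w) * expR (w ^+ 2 / 2) / c0)
  (w * mills w - 1) by [].
apply: is_derive_eq.
rewrite /GRing.scale/= /mills expRN; field.
by rewrite !gt_eqF ?expR_gt0.
Qed.

Lemma mills_ge0 w : 0 <= mills w.
Proof.
by rewrite /mills !mulr_ge0 ?expR_ge0 ?subr_ge0 ?Phi_le1// invr_ge0 ltW ?normal_peak1_gt0.
Qed.

(* [c0 exp(- w^2 / 2) / w - (1 - Phi w)] decreases to its limit [0]. *)
Lemma mills_le_inv w : 0 < w -> w * mills w <= 1.
Proof.
move=> w0; have c0p := normal_peak1_gt0.
pose D u : R := c0 * expR (- (u ^+ 2 / 2)) / u - (1 - Phi u).
suff D0 : 0 <= D w.
  have -> : mills w = (c0 * expR (- (w ^+ 2 / 2)) / w - D w) * expR (w ^+ 2 / 2) / c0.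
    by rewrite /D /mills; congr (_ * _ / _); ring.
  rewrite expRN mulrBl mulrBl mulrBr.
  have -> : w * (c0 * (expR (w ^+ 2 / 2))^-1 / w * expR (w ^+ 2 / 2) / c0) = 1.
    by field; rewrite !gt_eqF ?expR_gt0.
  by rewrite gerBl !mulr_ge0 ?invr_ge0 ?expR_ge0// ltW.
have Dle u : w <= u -> D u <= D w.
  move=> wu; have [c|c /andP[wc _] E] := @is_derive_mvt R D
    (fun u => - (c0 * expR (- (u ^+ 2 / 2)) / u ^+ 2)) w u wu.
    move=> /andP[wc _]; have cp : 0 < c by exact: lt_le_trans wc.
    have dP := is_derive_Phi c; have cN0 : c != 0 by rewrite gt_eqF.
    have dV : is_derive c 1 (fun y : R => y^-1) (- c ^- 2 *: 1).
      exact: (@is_deriveV R id c 1 1).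
    rewrite /D; apply: is_derive_eq.
    by rewrite /GRing.scale/=; field.
  have cp : 0 < c by exact: lt_le_trans wc.
  rewrite -subr_le0 E nmulr_rle0 ?subr_ge0// oppr_lt0.
  by rewrite divr_gt0 ?mulr_gt0 ?exprn_gt0 ?expR_gt0.
have Dlb u : w <= u -> - (1 - Phi u) <= D w.
  move=> wu; apply: le_trans (Dle u wu); rewrite lerDr.
  by rewrite divr_ge0 ?mulr_ge0 ?expR_ge0 ?(ltW c0p) ?(le_trans (ltW w0) wu).
have cl : - (1 - Phi u) @[u --> +oo%R] --> (- (1 - 1) : R).
  apply: cvgN; apply: cvgB; last exact: Phi_cvg1.
  exact: (@cvg_cst R).
have cr : (fun=> D w) x @[x --> (+oo%R : set_system R)] --> D w by exact: (@cvg_cst R).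
have := ler_cvg_to cl cr; rewrite subrr oppr0; apply.
near=> u; apply: Dlb; near: u; apply: nbhs_pinfty_ge; exact: num_real.
Unshelve. all: by end_near. Qed.

Lemma mills0 : mills 0 = (2 * c0)^-1.
Proof.
rewrite /mills Phi0 expr0n/= mul0r expR0; field.
by rewrite gt_eqF ?normal_peak1_gt0.
Qed.

Lemma mills_le_mills0 w : 0 <= w -> mills w <= mills 0.
Proof.
move=> w0; have [c|c /andP[c0 _] E] := @is_derive_mvt R mills
    (fun w => w * mills w - 1) 0 w w0.
  by move=> _; exact: is_derive_mills.
rewrite -subr_le0 E mulr_le0_ge0 ?subr0// subr_le0.
move: c0; rewrite le_eqVlt => /predU1P[<-|c0]; first by rewrite mul0r.
exact: mills_le_inv.
Qed.

Lemma mills0_le2 : mills 0 <= 2.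
Proof.
rewrite mills0 invfM /normal_peak invrK expr1n mul1r.
set s := Num.sqrt _; have s0 : 0 <= s by exact: sqrtr_ge0.
have ss : s ^+ 2 = pi *+ 2 by rewrite sqr_sqrtr// mulrn_wge0// pi_ge0.
have := pihalf_lt2 R; move: ss; rewrite -mulr_natr expr2; nra.
Qed.

Lemma mills_le2 w : 0 <= w -> mills w <= 2.
Proof. by move=> /mills_le_mills0 /le_trans; apply; exact: mills0_le2. Qed.

(** Only the mass of [[w, w + 1/w]] is counted. There the exponent drops by at most
    [(2 + 1/w^2) / 2 <= 2], and [e^(-2) >= 2^(-4) >= 1/30] because [e^(-1/2) >= 1/2]. *)
Lemma mills_lb w : 1 <= w -> (30 * w)^-1 <= mills w.
Proof.
move=> w1; have w0 : 0 < w by exact: lt_le_trans w1.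
have c0p := normal_peak1_gt0.
have wV : 0 <= w^-1 <= 1 by rewrite invr_ge0 ltW//= invf_le1.
have wle : w <= w + w^-1 by rewrite lerDl; case/andP: wV.
have [c|c /andP[wc cw] E] := @is_derive_mvt R (@Phi R)
    (fun w => c0 * expR (- (w ^+ 2 / 2))) w (w + w^-1) wle.
  by move=> _; exact: is_derive_Phi.
have T1 : c0 * expR (- (c ^+ 2 / 2)) / w <= 1 - Phi w.
  have := Phi_le1 (w + w^-1); have : w + w^-1 - w = w^-1 by ring.
  by move: E => /[swap] -> ; lra.
rewrite /mills.
have T2 : c0 * expR (- (c ^+ 2 / 2)) / w * expR (w ^+ 2 / 2) / c0 <=
    (1 - Phi w) * expR (w ^+ 2 / 2) / c0.
  by rewrite ler_wpM2r ?invr_ge0 ?(ltW c0p)// ler_wpM2r ?expR_ge0.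
apply: le_trans T2.
have -> : c0 * expR (- (c ^+ 2 / 2)) / w * expR (w ^+ 2 / 2) / c0 =
    expR (w ^+ 2 / 2 - c ^+ 2 / 2) / w.
  by rewrite expRD; field; rewrite !gt_eqF.
rewrite invfM ler_wpM2r ?invr_ge0 ?(ltW w0)//.
apply: (@le_trans _ _ (expR (- (1 + 1)))).
  have e2 : 2^-1 <= expR (- 2^-1) :> R.
    by have := expR_ge1Dx (- 2^-1 : R); lra.
  have -> : - (1 + 1) = - 2^-1 * 4%:R :> R by lra.
  rewrite expRM_natr; apply: (@le_trans _ _ (2^-1 ^+ 4)).
    by rewrite !exprS expr0; lra.
  by rewrite lerXn2r// nnegrE ?expR_ge0.
rewrite ler_expR.
have ww : w * w^-1 = 1 by rewrite mulfV// gt_eqF.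
case/andP: wV => v0 v1.
have : c ^+ 2 <= (w + w^-1) ^+ 2.
  by rewrite ler_sqr ?nnegrE ?(le_trans _ wc) ?addr_ge0 ?(ltW w0).
rewrite !expr2; nra.
Qed.

End mills_ratio.

Lemma is_derive_mvt_minmax (R : realType) (f df : R -> R) (a b : R) :
  (forall c, Num.min a b <= c <= Num.max a b -> is_derive c 1 f (df c)) ->
  exists2 c, Num.min a b <= c <= Num.max a b & f b - f a = df c * (b - a).
Proof.
have [ab|/ltW ba] := leP a b => fdf; first exact: is_derive_mvt.
have [c cab E] := is_derive_mvt ba fdf; exists c => //.
by rewrite -opprB E -mulrN opprB.
Qed.

(** * Explicit solution of Stein's equation for the tail function *)

Section stein_solution.
Context {R : realType}.
Variable x : R.
Hypothesis x1 : 1 <= x.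
Implicit Types u w t : R.

Local Notation c0 := (@normal_peak R 1).

Definition tailfun w : R := if 0 < w then expR (- (x * w)) else 0.

(* The mean of [tailfun] under the standard normal law. *)
Definition tailfun_mean : R := c0 * mills x.

Local Notation N := tailfun_mean.

(* [steinR] and [steinL] solve [f' w - w f w = tailfun w - N] on the two half
   lines, are bounded there, and agree at [0] because [mills 0 = 1 / (2 c0)]. *)
Definition steinR w : R := N * mills w - expR (- (x * w)) * mills (w + x).

Definition steinL w : R := - (N * mills (- w)).

Definition stein w : R := if 0 <= w then steinR w else steinL w.

(** The derivative of [stein] away from [0], read off from the equation. At the kink it takes the
    left derivative, as [tailfun 0 = 0], and Stein's equation holds everywhere by definition. *)
Definition stein' w : R := w * stein w + tailfun w - N.

Let x0 : 0 < x. Proof. exact: lt_le_trans x1. Qed.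

Lemma tailfun_mean_ge0 : 0 <= N.
Proof. by rewrite mulr_ge0 ?mills_ge0// ltW// normal_peak1_gt0. Qed.

Lemma tailfun_mean_le : N <= 2^-1.
Proof.
apply: (@le_trans _ _ (c0 * mills 0)).
  by rewrite ler_wpM2l ?mills_le_mills0 ?ltW ?normal_peak1_gt0.
by rewrite mills0 invfM mulrCA mulfV ?mulr1// gt_eqF ?normal_peak1_gt0.
Qed.

Lemma tailfun_ge0 w : 0 <= tailfun w.
Proof. by rewrite /tailfun; case: ifP => // _; exact: expR_ge0. Qed.

Let exp_le1 w : 0 <= w -> 0 <= expR (- (x * w)) <= 1.
Proof. by move=> w0; rewrite expR_ge0 expR_le1 oppr_le0 mulr_ge0// ltW. Qed.

Lemma tailfun_le1 w : tailfun w <= 1.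
Proof.
by rewrite /tailfun; case: ifPn => // /ltW /exp_le1 /andP[].
Qed.

(** The two terms serve the two parts of the right side: [N * mills] produces [- N], and
    [- e^(-x w) mills (w + x)] produces [e^(-x w)], since the [x] from the exponential cancels the
    shift in [(w + x) * mills (w + x)]. *)
Lemma is_derive_steinR w :
  is_derive w 1 steinR (w * steinR w + expR (- (x * w)) - N).
Proof.
have dm := is_derive_mills w.
have dmx : is_derive w 1 (fun w => mills (w + x)) ((w + x) * mills (w + x) - 1).
  have := @is_derive1_comp R (@mills R) (fun w => w + x) w _ 1
    (is_derive_mills (w + x)).
  by rewrite mulr1; apply; apply: is_derive_eq; rewrite addr0.
suff : is_derive w 1 (fun w => N * mills w - expR (- (x * w)) * mills (w + x))
  (w * steinR w + expR (- (x * w)) - N) by [].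
apply: is_derive_eq.
by rewrite /GRing.scale/= /steinR; ring.
Qed.

Lemma is_derive_steinL w : is_derive w 1 steinL (w * steinL w - N).
Proof.
have dmx : is_derive w 1 (fun w => mills (- w)) (- (- w * mills (- w) - 1)).
  have := @is_derive1_comp R (@mills R) (fun w => - w) w _ (- 1)
    (is_derive_mills (- w)).
  by rewrite mulrN1; apply; apply: is_derive_eq.
suff : is_derive w 1 (fun w => - (N * mills (- w))) (w * steinL w - N) by [].
apply: is_derive_eq.
by rewrite /GRing.scale/= /steinL; ring.
Qed.

Lemma steinR0 : steinR 0 = steinL 0.
Proof.
rewrite /steinR /steinL mulr0 oppr0 expR0 add0r /N mills0; field.
by rewrite gt_eqF ?normal_peak1_gt0.
Qed.

Lemma steinE_le0 w : w <= 0 -> stein w = steinL w.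
Proof.
rewrite le_eqVlt /stein => /predU1P[->|w0]; first by rewrite lexx steinR0.
by rewrite leNgt w0.
Qed.

Lemma stein'E_gt0 w : 0 < w -> stein' w = w * steinR w + expR (- (x * w)) - N.
Proof. by move=> w0; rewrite /stein' /stein /tailfun (ltW w0) w0. Qed.

Lemma stein'E_le0 w : w <= 0 -> stein' w = w * steinL w - N.
Proof.
by move=> w0; rewrite /stein' steinE_le0// /tailfun ltNge w0/= addr0.
Qed.

Let norm_steinR w : 0 <= w -> `|steinR w| <= 2.
Proof.
move=> w0; have N0 := tailfun_mean_ge0; have N1 := tailfun_mean_le.
have /andP[e0 e1] := exp_le1 w0.
have m0 := mills_ge0 w; have m1 := mills_le2 w0.
have wx : 0 <= w + x by rewrite addr_ge0// ltW.
have p0 := mills_ge0 (w + x); have p1 := mills_le2 wx.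
rewrite /steinR ler_norml; apply/andP; split; nra.
Qed.

Let norm_steinL w : w <= 0 -> `|steinL w| <= 2.
Proof.
move=> w0; have N0 := tailfun_mean_ge0; have N1 := tailfun_mean_le.
have wN : 0 <= - w by rewrite oppr_ge0.
have m0 := mills_ge0 (- w); have m1 := mills_le2 wN.
rewrite /steinL ler_norml; apply/andP; split; nra.
Qed.

Let mills_mul w : 0 <= w -> 0 <= w * mills w <= 1.
Proof.
rewrite le_eqVlt => /predU1P[<-|w0]; first by rewrite mul0r lexx ler01.
by rewrite mulr_ge0 ?mills_ge0 ?mills_le_inv// ltW.
Qed.

Let norm_mul_steinR w : 0 <= w -> `|w * steinR w| <= 1.
Proof.
move=> w0; have N0 := tailfun_mean_ge0; have N1 := tailfun_mean_le.
have /andP[e0 e1] := exp_le1 w0.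
have /andP[m0 m1] := mills_mul w0.
have wx : 0 <= w + x by rewrite addr_ge0// ltW.
have p0 := mills_ge0 (w + x); have /andP[_ p1] := mills_mul wx.
have q1 : w * mills (w + x) <= 1.
  by apply: le_trans p1; rewrite ler_wpM2r// lerDl ltW.
have q0 : 0 <= w * mills (w + x) by rewrite mulr_ge0.
have -> : w * steinR w = N * (w * mills w) - expR (- (x * w)) * (w * mills (w + x)).
  by rewrite /steinR; ring.
rewrite ler_norml; apply/andP; split; nra.
Qed.

Let norm_mul_steinL w : w <= 0 -> `|w * steinL w| <= 1.
Proof.
move=> w0; have N0 := tailfun_mean_ge0; have N1 := tailfun_mean_le.
have wN : 0 <= - w by rewrite oppr_ge0.
have /andP[m0 m1] := mills_mul wN.
have -> : w * steinL w = N * (- w * mills (- w)) by rewrite /steinL; ring.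
rewrite ler_norml; apply/andP; split; nra.
Qed.

Lemma norm_stein w : `|stein w| <= 2.
Proof.
have [w0|/ltW w0] := leP 0 w; first by rewrite /stein w0 norm_steinR.
by rewrite steinE_le0// norm_steinL.
Qed.

Let norm_dsteinR w : 0 <= w -> `|w * steinR w + expR (- (x * w)) - N| <= 2.
Proof.
move=> w0; have N0 := tailfun_mean_ge0; have N1 := tailfun_mean_le.
have /andP[e0 e1] := exp_le1 w0; have := norm_mul_steinR w0.
rewrite !ler_norml; lra.
Qed.

Let norm_dsteinL w : w <= 0 -> `|w * steinL w - N| <= 2.
Proof.
move=> w0; have N0 := tailfun_mean_ge0; have N1 := tailfun_mean_le.
have := norm_mul_steinL w0; rewrite !ler_norml; lra.
Qed.

(** The product [w * stein w] is bounded because [w * mills w <= 1]. Neither this bound nor that of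
    [stein] depends on [x]. *)
Lemma norm_stein' w : `|stein' w| <= 2.
Proof.
have [w0|w0] := ltP 0 w; first by rewrite stein'E_gt0// norm_dsteinR// ltW.
by rewrite stein'E_le0// norm_dsteinL.
Qed.

(** The mean value theorem works on each closed half line; points on opposite sides of the kink are
    compared through [0], where the two branches agree. *)
Lemma stein_lipschitz u w : `|stein u - stein w| <= 2 * `|u - w|.
Proof.
have lipR a b : 0 <= a -> 0 <= b -> `|steinR b - steinR a| <= 2 * `|b - a|.
  move=> a0 b0; have [c _|c /andP[mc _] ->] := @is_derive_mvt_minmax R steinR
    (fun w => w * steinR w + expR (- (x * w)) - N) a b.
    exact: is_derive_steinR.
  by rewrite normrM ler_wpM2r// norm_dsteinR// (le_trans _ mc)// le_min a0.
have lipL a b : a <= 0 -> b <= 0 -> `|steinL b - steinL a| <= 2 * `|b - a|.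
  move=> a0 b0; have [c _|c /andP[_ cM] ->] := @is_derive_mvt_minmax R steinL
    (fun w => w * steinL w - N) a b.
    exact: is_derive_steinL.
  by rewrite normrM ler_wpM2r// norm_dsteinL// (le_trans cM)// ge_max a0.
wlog wu : u w / w <= u.
  move=> H; have [|/ltW uw] := leP w u; first exact: H.
  by rewrite distrC [`|u - w|]distrC; exact: H.
have [w0|w0] := leP 0 w.
  by rewrite /stein w0 (le_trans w0 wu) lipR// (le_trans w0).
have [u0|u0] := leP u 0.
  by rewrite !steinE_le0 ?(ltW w0)// lipL// ltW.
rewrite (steinE_le0 (ltW w0)) /stein (ltW u0).
have -> : steinR u - steinL w = (steinR u - steinR 0) + (steinL 0 - steinL w).
  by rewrite steinR0; ring.
apply: (le_trans (ler_normD _ _)).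
have := lipR 0 u (lexx 0) (ltW u0); have := lipL w 0 (ltW w0) (lexx 0).
rewrite !subr0 sub0r normrN (gtr0_norm u0) (ltr0_norm w0) (@gtr0_norm _ (u - w)); last first.
  by rewrite subr_gt0 (lt_trans w0 u0).
lra.
Qed.

Lemma mul_stein_diff w t :
  `|(w + t) * stein (w + t) - w * stein w| <= (2 * `|w| + 2) * `|t|.
Proof.
have -> : (w + t) * stein (w + t) - w * stein w =
    w * (stein (w + t) - stein w) + t * stein (w + t) by ring.
apply: (le_trans (ler_normD _ _)); rewrite !normrM.
have := stein_lipschitz (w + t) w; rewrite addrAC subrr add0r.
have := norm_stein (w + t); have := normr_ge0 w; have := normr_ge0 t.
by nra.
Qed.

Let exp_lip u w : 0 <= u -> 0 <= w ->
  `|expR (- (x * u)) - expR (- (x * w))| <= x * `|u - w|.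
Proof.
move=> u0 w0; have [c _|c /andP[mc _] ->] := @is_derive_mvt_minmax R
    (fun w => expR (- (x * w))) (fun w => - x * expR (- (x * w))) w u.
  by apply: is_derive_eq; rewrite /GRing.scale/=; ring.
have c0 : 0 <= c by rewrite (le_trans _ mc)// le_min w0.
have /andP[e0 e1] := exp_le1 c0.
rewrite !normrM normrN (gtr0_norm x0) (ger0_norm e0) ler_wpM2r//.
by rewrite ler_piMr// ltW.
Qed.

Lemma tailfun_diff w t :
  `|tailfun (w + t) - tailfun w| <= x * `|t| + (`|w| <= `|t|)%R%:R.
Proof.
have t0 := normr_ge0 t; have xt : 0 <= x * `|t| by rewrite mulr_ge0// ltW.
have [wt|wt] := leP `|w| `|t|; rewrite /= ?addr0.
  have := tailfun_ge0 w; have := tailfun_ge0 (w + t).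
  have := tailfun_le1 w; have := tailfun_le1 (w + t).
  by rewrite ler_norml mulr1n; lra.
rewrite /tailfun; have [w0|w0] := ltP 0 w.
  have wt0 : 0 < w + t by move: wt; rewrite (gtr0_norm w0) ltr_norml; lra.
  rewrite wt0 (le_trans (exp_lip (ltW wt0) (ltW w0)))//.
  by rewrite addrAC subrr add0r.
have wt0 : w + t <= 0 by move: wt; rewrite (ler0_norm w0) ltr_norml; lra.
by rewrite ltNge wt0/= subrr normr0.
Qed.

(* The indicator pays for the jump of [tailfun] at [0]: [w] and [w + t] can lie on
   different sides of it only when [|w| <= |t|]. *)
Lemma stein'_diff w t : `|stein' (w + t) - stein' w| <=
  (2 * `|w| + 2 + x) * `|t| + (`|w| <= `|t|)%R%:R.
Proof.
have -> : stein' (w + t) - stein' w =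
  ((w + t) * stein (w + t) - w * stein w) + (tailfun (w + t) - tailfun w).
  by rewrite /stein'; ring.
apply: (le_trans (ler_normD _ _)).
have := mul_stein_diff w t; have := tailfun_diff w t; lra.
Qed.

(** If [|w| <= |t|] the kink may be crossed, and first-order bounds give [4 |t|], paid by the
    indicator. Otherwise the segment stays on one side of [0], and the mean value theorem applies
    with [stein'_diff], whose own indicator vanishes there. *)
Lemma stein_taylor w t : `|stein (w + t) - stein w - t * stein' w| <=
  `|t| * ((2 * `|w| + 2 + x) * `|t| + 4 * (`|w| <= `|t|)%R%:R).
Proof.
have t0 := normr_ge0 t; have w0 := normr_ge0 w.
have wtt : (w + t) - w = t by ring.
have [wt|wt] := leP `|w| `|t|; rewrite /= ?mulr0 ?addr0.
  apply: (le_trans (ler_normB _ _)); rewrite normrM.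
  have := stein_lipschitz (w + t) w; rewrite wtt.
  have : `|t| * `|stein' w| <= `|t| * 2 by rewrite ler_wpM2l// norm_stein'.
  have : 0 <= `|t| * ((2 * `|w| + 2 + x) * `|t|).
    by rewrite !mulr_ge0// addr_ge0 ?(ltW x0)// addr_ge0// mulr_ge0.
  rewrite mulr1 mulrDr; lra.
have K c : Num.min w (w + t) <= c <= Num.max w (w + t) ->
    `|stein' c - stein' w| <= (2 * `|w| + 2 + x) * `|t|.
  move=> /andP[mc cM]; have ct : `|c - w| <= `|t|.
    move: mc cM; rewrite ge_min le_max ler_norml => /orP[] H1 /orP[] H2;
      have := ler_norm t; have := ler_norm (- t); rewrite normrN; lra.
  have := stein'_diff w (c - w); have -> : w + (c - w) = c by ring.
  rewrite [_ <= `|c - w|]leNgt (le_lt_trans ct wt)/= addr0 => /le_trans; apply.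
  by rewrite ler_wpM2l// addr_ge0 ?(ltW x0)// addr_ge0// mulr_ge0.
have [w1|w1] := ltP 0 w.
  have wt0 : 0 < w + t by move: wt; rewrite (gtr0_norm w1) ltr_norml; lra.
  rewrite /stein (ltW w1) (ltW wt0).
  have [c _|c cI ->] := @is_derive_mvt_minmax R steinR
    (fun w => w * steinR w + expR (- (x * w)) - N) w (w + t).
    exact: is_derive_steinR.
  have c1 : 0 < c.
    by case/andP: cI => mc _; rewrite (lt_le_trans _ mc)// lt_min w1.
  by rewrite wtt -stein'E_gt0// mulrC -mulrBr normrM ler_wpM2l// K.
have wt0 : w + t <= 0 by move: wt; rewrite (ler0_norm w1) ltr_norml; lra.
rewrite !steinE_le0//.
have [c _|c cI ->] := @is_derive_mvt_minmax R steinL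
  (fun w => w * steinL w - N) w (w + t).
  exact: is_derive_steinL.
have c1 : c <= 0.
  by case/andP: cI => _ cM; rewrite (le_trans cM)// ge_max w1.
by rewrite wtt -stein'E_le0// mulrC -mulrBr normrM ler_wpM2l// K.
Qed.

End stein_solution.

Section stein_measurable.
Context {R : realType}.
Variable x : R.

Lemma measurable_mills : measurable_fun setT (@mills R).
Proof.
apply: continuous_measurable_fun => w; apply: differentiable_continuous.
by apply/derivable1_diffP; have [] := is_derive_mills w.
Qed.

Lemma measurable_tailfun : measurable_fun setT (tailfun x).
Proof.
apply: measurable_fun_ifT => //; first exact: measurable_fun_ltr.
by apply: measurableT_comp => //; apply: measurableT_comp.
Qed.

Lemma measurable_stein : measurable_fun setT (stein x).
Proof.
apply: measurable_fun_ifT; first exact: measurable_fun_ler.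
  apply: measurable_funB.
    by apply: measurable_funM => //; exact: measurable_mills.
  apply: measurable_funM.
    by apply: measurableT_comp => //; apply: measurableT_comp.
  by apply: measurableT_comp; [exact: measurable_mills|exact: measurable_funD].
apply: measurableT_comp => //; apply: measurable_funM => //.
by apply: measurableT_comp => //; exact: measurable_mills.
Qed.

Lemma measurable_stein' : measurable_fun setT (stein' x).
Proof.
apply: measurable_funB => //; apply: measurable_funD.
  by apply: measurable_funM => //; exact: measurable_stein.
exact: measurable_tailfun.
Qed.

End stein_measurable.

(** * Stein's method for sums of independent variables *)

Section leave_one_out.
Context d (T : measurableType d) (R : realType) (Q : probability T R) (n : nat).
Variable Y : 'I_n -> T -> R.
Hypothesis mY : forall i, measurable_fun setT (Y i).
Hypothesis indY : mutually_independent Q Y.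

Local Notation L1 f := (Q.-integrable setT (EFin \o f)).

Hypothesis lY3 : forall i, L1 (fun w => `|Y i w| ^+ 3).
Hypothesis Y0 : forall i, \int[Q]_w Y i w = 0.

Variables (b c : R) (i : 'I_n).
Hypothesis b0 : 0 < b.
Hypothesis Y2 : forall i, \int[Q]_w Y i w ^+ 2 <= b ^+ 2.
Hypothesis Y3 : forall i, \int[Q]_w `|Y i w| ^+ 3 <= b ^+ 3.
Hypothesis b_le : b ^+ 2 <= 4^-1.
Hypothesis c_le : `|c| <= 1.
Hypothesis v_ge : 3 / 4 <= \sum_(i < n) \int[Q]_w Y i w ^+ 2.
Hypothesis v_le : \sum_(i < n) \int[Q]_w Y i w ^+ 2 <= 5 / 4.

(** Omitting a summand is encoded as setting it to [0], so results stated for families indexed by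
    ['I_n] still apply. *)
Let Z k w := if k == i then 0 else Y k w.

Let ZE w : \sum_(k < n) Z k w = \sum_(k < n | k != i) Y k w.
Proof.
by rewrite [RHS]big_mkcond; apply: eq_bigr => k _; rewrite /Z; case: eqP.
Qed.

Let mZ k : measurable_fun setT (Z k).
Proof. by rewrite /Z; case: (k == i). Qed.

Let indZ : mutually_independent Q Z.
Proof.
apply: (@mutually_independent_comp _ _ _ _ _ _ indY
  (fun k y => if k == i then 0 else y)).
by move=> k; case: (k == i).
Qed.

Let lZ3 k : L1 (fun w => `|Z k w| ^+ 3).
Proof.
rewrite /Z; case: (k == i) => //.
by under eq_fun do rewrite normr0 expr0n; exact: L1_cst.
Qed.

Let Z0 k : \int[Q]_w Z k w = 0.
Proof. by rewrite /Z; case: (k == i) => //; rewrite expectation_cst_real. Qed.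

Let EZ2 : \sum_(k < n) \int[Q]_w Z k w ^+ 2 =
  \sum_(k < n) \int[Q]_w Y k w ^+ 2 - \int[Q]_w Y i w ^+ 2.
Proof.
rewrite [in RHS](bigD1 i)//= addrAC subrr add0r [RHS]big_mkcond.
apply: eq_bigr => k _; rewrite /Z; case: eqP => //= _.
by rewrite expr0n expectation_cst_real.
Qed.

Let Y2_ge0 k : 0 <= \int[Q]_w Y k w ^+ 2.
Proof. by apply: Rintegral_ge0 => w _; exact: sqr_ge0. Qed.

(** Removing one summand costs at most [b ^+ 2 <= 1/4] of variance, which leaves the [1/2] that
    [concentration] asks for. *)
Lemma concentration_others (r : R) : 0 <= r ->
  \int[Q]_w (`|\sum_(k < n | k != i) Y k w + c| <= r)%R%:R <=
  8 * r + 16 * (n%:R * b ^+ 3).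
Proof.
have arith1 (u v : R) : 3 / 4 <= u -> v <= 4^-1 -> 2^-1 <= u - v by lra.
have arith2 (u v : R) : u <= 5 / 4 -> 0 <= v -> u - v <= 5 / 4 by lra.
move=> r0; under eq_Rintegral do rewrite -ZE.
have n0 : 0 < n%:R :> R by rewrite ltr0n; case: (n) i => // -[].
apply: concentration => //.
- by rewrite mulr_gt0// exprn_gt0.
- by rewrite EZ2 arith1// (le_trans (Y2 i)).
- by rewrite EZ2 arith2.
- apply: (@le_trans _ _ (\sum_(k < n) b ^+ 3)).
    apply: ler_sum => k _; rewrite /Z; case: (k == i) => //.
    by rewrite normr0 expr0n expectation_cst_real exprn_ge0// ltW.
  by rewrite sumr_const card_ord -[leLHS]mulr_natl.
Qed.

Lemma L1_others : L1 (fun w => \sum_(k < n | k != i) Y k w + c).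
Proof.
apply: L1D; last exact: L1_cst.
by apply: L1_sum => k _; exact: L1_of_cube.
Qed.

Lemma expectation_abs_others :
  \int[Q]_w `|\sum_(k < n | k != i) Y k w + c| <= 3.
Proof.
have arith (u v : R) : u <= 5 / 4 -> 0 <= v -> 3 / 2 + 2^-1 * (u - v) <= 3.
  by lra.
have lZ k := L1_of_cube mZ lZ3 k.
have lZ2 k := L1_sqr_of_cube mZ lZ3 k.
have [lS ES] := expectation_sum_sqr mZ indZ lZ lZ2 Z0.
apply: (@le_trans _ _ (\int[Q]_w (3 / 2 + 2^-1 * (\sum_(k < n) Z k w) ^+ 2))).
  apply: Rintegral_le.
  - exact: integrable_norm L1_others.
  - by apply: L1D; [exact: L1_cst|exact: L1Zl].
  move=> w; rewrite ZE (le_trans (ler_normD _ _))//.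
  have := abs_le_sqr (\sum_(k < n | k != i) Y k w) (@ltr01 R).
  by move: c_le; lra.
rewrite RintegralD//; [|exact: L1_cst|exact: L1Zl].
by rewrite expectation_cst_real RintegralZl// ES EZ2 arith.
Qed.

End leave_one_out.

Section stein_bound.
Context d (T : measurableType d) (R : realType) (Q : probability T R) (n : nat).
Variable Y : 'I_n -> T -> R.
Hypothesis mY : forall i, measurable_fun setT (Y i).
Hypothesis indY : mutually_independent Q Y.

Local Notation L1 f := (Q.-integrable setT (EFin \o f)).

Hypothesis lY3 : forall i, L1 (fun w => `|Y i w| ^+ 3).
Hypothesis Y0 : forall i, \int[Q]_w Y i w = 0.

Variables (b c x : R).
Hypothesis b0 : 0 < b.
Hypothesis Y1 : forall i, \int[Q]_w `|Y i w| <= b.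
Hypothesis Y2 : forall i, \int[Q]_w Y i w ^+ 2 <= b ^+ 2.
Hypothesis Y3 : forall i, \int[Q]_w `|Y i w| ^+ 3 <= b ^+ 3.
Hypothesis b_le : b ^+ 2 <= 4^-1.
Hypothesis c_le : `|c| <= 1.
Hypothesis v_ge : 3 / 4 <= \sum_(i < n) \int[Q]_w Y i w ^+ 2.
Hypothesis v_le : \sum_(i < n) \int[Q]_w Y i w ^+ 2 <= 5 / 4.
Hypothesis x1 : 1 <= x.

Let V w := \sum_(k < n) Y k w + c.
Let W i w := \sum_(k < n | k != i) Y k w + c.
Let g : R := n%:R * b ^+ 3.
Let v i := \int[Q]_w Y i w ^+ 2.

Let x0 : 0 <= x. Proof. exact: le_trans x1. Qed.

Let g0 : 0 <= g. Proof. by rewrite mulr_ge0// exprn_ge0// ltW. Qed.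

Let v0 i : 0 <= v i.
Proof. by apply: Rintegral_ge0 => w _; exact: sqr_ge0. Qed.

Let VE i w : V w = W i w + Y i w.
Proof. by rewrite /V (bigD1 i)//= /W; ring. Qed.

Let mV : measurable_fun setT V.
Proof. by apply: measurable_funD => //; exact: measurable_sum. Qed.

Let mW i : measurable_fun setT (W i).
Proof. exact: measurable_sum_others. Qed.

Let lY i : L1 (Y i). Proof. exact: L1_of_cube. Qed.

Let lY2 i : L1 (fun w => Y i w ^+ 2). Proof. exact: L1_sqr_of_cube. Qed.

Let lW i : L1 (W i). Proof. exact: L1_others. Qed.

Let lb (Z : T -> R) (F : R -> R) (k : R) : measurable_fun setT Z ->
  measurable_fun setT F -> (forall w, `|F w| <= k) -> L1 (fun w => F (Z w)).
Proof.
move=> mZ mF Fk; apply: (@L1_bounded _ _ _ _ _ k) => //.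
exact: measurableT_comp.
Qed.

Let lbM (X Z : T -> R) (F : R -> R) (k : R) : L1 X -> measurable_fun setT Z ->
  measurable_fun setT F -> (forall w, `|F w| <= k) -> L1 (fun w => X w * F (Z w)).
Proof.
move=> lX mZ mF Fk; apply: (@L1_le _ _ _ _ _ (fun w => k * `|X w|)).
- apply: measurable_funM; first exact: L1_measurable lX.
  exact: measurableT_comp.
- by move=> w; rewrite normrM mulrC ler_wpM2r.
- by apply: L1Zl; exact: integrable_norm.
Qed.

Let lin (X : T -> R) (i : 'I_n) : measurable_fun setT X ->
  L1 X -> L1 (fun w => X w * (`|W i w| <= `|Y i w|)%R%:R).
Proof.
move=> mX lX; apply: (@L1_le _ _ _ _ _ (fun w => `|X w|)).
- by apply: measurable_funM => //; apply: measurable_ler_ind; exact: measurableT_comp.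
- by move=> w; rewrite normrM normr_nat ler_piMr// lern1 leq_b1.
- exact: integrable_norm.
Qed.

(** The coefficient of [|t|] in [stein'_diff]. Evaluated at [W i] it is independent of [Y i], so
    expectations factor. *)
Let Wlip (z : R) := 2 * `|z| + 2 + x.

Let mWlip : measurable_fun setT Wlip.
Proof.
apply: measurable_funD => //; apply: measurable_funD => //.
by apply: measurable_funM.
Qed.

Let lWlip i : L1 (fun w => Wlip (W i w)).
Proof.
apply: L1D; last exact: L1_cst; apply: L1D; last exact: L1_cst.
by apply: L1Zl; exact: integrable_norm.
Qed.

Let EWlip i : 0 <= \int[Q]_w Wlip (W i w) <= x + 8.
Proof.
have arith (e : R) : e <= 3 -> 2 * e + 2 + x <= x + 8 by lra.
rewrite Rintegral_ge0 /=; last by move=> w _; rewrite !addr_ge0// mulr_ge0.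
rewrite RintegralD//; [|apply: L1D; last exact: L1_cst|exact: L1_cst]; last first.
  by apply: L1Zl; exact: integrable_norm.
rewrite RintegralD//; [|apply: L1Zl; exact: integrable_norm|exact: L1_cst].
rewrite !expectation_cst_real RintegralZl//; last exact: integrable_norm.
by apply: arith; exact: (expectation_abs_others mY indY lY3 Y0 i c_le v_le).
Qed.

(** The contribution of the jump: concentration of [W i] at the random radius [|Y i|]. The weight
    [F] will be [1] when [stein'] is compared and [y ^+ 2] in the Taylor remainder. *)
Let ind_le i (F : R -> R) : measurable_fun setT F -> (forall y, 0 <= F y) ->
  L1 (fun w => F (Y i w)) -> L1 (fun w => F (Y i w) * `|Y i w|) ->
  \int[Q]_w (F (Y i w) * (`|W i w| <= `|Y i w|)%R%:R) <=
  8 * \int[Q]_w (F (Y i w) * `|Y i w|) + 16 * g * \int[Q]_w F (Y i w).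
Proof.
move=> mF F0 lF lFY.
have E w : F (Y i w) * (8 * `|Y i w| + 16 * g) =
    8 * (F (Y i w) * `|Y i w|) + 16 * g * F (Y i w) by ring.
have lE : L1 (fun w => F (Y i w) * (8 * `|Y i w| + 16 * g)).
  by under eq_fun do rewrite E; apply: L1D; exact: L1Zl.
have /le_trans := @expectation_joint_le _ _ _ Q (Y i) (W i) F
  (fun r => 8 * r + 16 * g) (mY i) (mW i)
  (@sum_others_indep _ _ _ _ _ _ mY indY i c) mF F0
  (fun r r0 => concentration_others mY indY lY3 Y0 c i b0 Y2 Y3 b_le v_ge v_le r0)
  lF lE; apply.
under eq_Rintegral do rewrite E.
by rewrite RintegralD// ?RintegralZl//; exact: L1Zl.
Qed.

(** The price of putting one summand back inside [stein']. First order in [b] is enough, since the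
    difference will be multiplied by [v i <= b ^+ 2]. *)
Let diff_stein' i :
  `|\int[Q]_w stein' x (V w) - \int[Q]_w stein' x (W i w)| <=
  (x + 16) * b + 16 * g.
Proof.
have lV' : L1 (fun w => stein' x (V w)).
  by apply: lb => //; [exact: measurable_stein'|exact: norm_stein'].
have lW' : L1 (fun w => stein' x (W i w)).
  by apply: lb => //; [exact: measurable_stein'|exact: norm_stein'].
rewrite -RintegralB//.
have mnorm : measurable_fun setT (fun y : R => `|y|) by [].
have [lA EA] := expectation_others mY indY (i := i) (c := c)
  mnorm mWlip (integrable_norm (lY i)) (lWlip i).
have lI := @lin (fun=> 1) i (measurable_cst _) (L1_cst _ _).
apply: (@le_trans _ _ (\int[Q]_w (`|Y i w| * Wlip (W i w) +
  1 * (`|W i w| <= `|Y i w|)%R%:R))).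
  apply: norm_Rintegral_le; [exact: L1B|exact: L1D|].
  by move=> w; rewrite (VE i) mul1r mulrC; exact: stein'_diff.
rewrite RintegralD// EA.
have /andP[e0 e1] := EWlip i.
have lY1 : L1 (fun w => 1 * `|Y i w|).
  by under eq_fun do rewrite mul1r; exact: integrable_norm.
have I1 := @ind_le i (fun=> 1) (measurable_cst _) (fun=> ler01) (L1_cst _ _) lY1.
have {}I1 := le_trans I1 (_ : _ <= 8 * b + 16 * g).
have -> : (x + 16) * b + 16 * g = b * (x + 8) + (8 * b + 16 * g) by ring.
apply: lerD; last first.
  apply: I1; rewrite expectation_cst_real mulr1 lerD2r ler_wpM2l//.
  by under eq_Rintegral do rewrite mul1r.
by apply: ler_pM => //; apply: Rintegral_ge0.
Qed.

(** Expansion around [W i]: the term [Y i * stein (W i)] has mean zero, [Y i ^+ 2 * stein' (W i)]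
    factors into the main term, and what remains is a third-order term plus a jump of weight
    [Y i ^+ 2]. *)
Let diff_mul_stein i :
  `|\int[Q]_w (Y i w * stein x (V w)) - v i * \int[Q]_w stein' x (W i w)| <=
  (x + 40) * b ^+ 3 + 64 * g * v i.
Proof.
have ns := norm_stein x1; have ns' := norm_stein' x1.
have ms := measurable_stein x; have ms' := measurable_stein' x.
have lYV : L1 (fun w => Y i w * stein x (V w)) by exact: lbM ns.
have lYW : L1 (fun w => Y i w * stein x (W i w)) by exact: lbM ns.
have lYW' : L1 (fun w => Y i w ^+ 2 * stein' x (W i w)) by exact: lbM ns'.
have lsW : L1 (fun w => stein x (W i w)) by exact: lb ns.
have lsW' : L1 (fun w => stein' x (W i w)) by exact: lb ns'.
have [_ EYW] := expectation_others mY indY (i := i) (c := c)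
  (measurable_id (D := setT)) ms (lY i) lsW.
have mcube : measurable_fun setT (fun y : R => `|y| ^+ 3).
  by apply: measurable_funX.
have msqr : measurable_fun setT (fun y : R => y ^+ 2) by apply: measurable_funX.
have [_ EYW'] := expectation_others mY indY (i := i) (c := c) msqr ms' (lY2 i) lsW'.
have <- : \int[Q]_w (Y i w * stein x (V w) - Y i w * stein x (W i w) -
    Y i w ^+ 2 * stein' x (W i w)) =
  \int[Q]_w (Y i w * stein x (V w)) - v i * \int[Q]_w stein' x (W i w).
  rewrite RintegralB//; last exact: L1B.
  by rewrite RintegralB// EYW Y0 mul0r subr0 EYW'.
have [lA EA] := expectation_others mY indY (i := i) (c := c)
  mcube mWlip (lY3 i) (lWlip i).
have mY2 : measurable_fun setT (fun w => Y i w ^+ 2) by exact: measurable_funX.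
have lI := lin i mY2 (lY2 i).
apply: (@le_trans _ _ (\int[Q]_w (`|Y i w| ^+ 3 * Wlip (W i w) +
  4 * (Y i w ^+ 2 * (`|W i w| <= `|Y i w|)%R%:R)))).
  apply: norm_Rintegral_le.
  - by apply: L1B => //; exact: L1B.
  - by apply: L1D => //; exact: L1Zl.
  move=> w; rewrite (VE i).
  have -> : Y i w * stein x (W i w + Y i w) - Y i w * stein x (W i w) -
      Y i w ^+ 2 * stein' x (W i w) =
    Y i w * (stein x (W i w + Y i w) - stein x (W i w) -
      Y i w * stein' x (W i w)) by ring.
  have -> : `|Y i w| ^+ 3 * Wlip (W i w) +
      4 * (Y i w ^+ 2 * (`|W i w| <= `|Y i w|)%R%:R) =
    `|Y i w| * (`|Y i w| * (Wlip (W i w) * `|Y i w| +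
      4 * (`|W i w| <= `|Y i w|)%R%:R)).
    by rewrite -(real_normK (num_real (Y i w))); ring.
  by rewrite normrM ler_wpM2l//; exact: stein_taylor.
rewrite RintegralD//; last exact: L1Zl.
rewrite RintegralZl// EA.
have /andP[e0 e1] := EWlip i.
have lY3' : L1 (fun w => Y i w ^+ 2 * `|Y i w|).
  have := lY3 i; under eq_fun do rewrite exprSr real_normK ?num_real//.
  by [].
have I1 := @ind_le i (fun y => y ^+ 2) msqr (@sqr_ge0 R) (lY2 i) lY3'.
have {}I1 := le_trans I1 (_ : _ <= 8 * b ^+ 3 + 16 * g * v i).
have -> : (x + 40) * b ^+ 3 + 64 * g * v i =
  b ^+ 3 * (x + 8) + 4 * (8 * b ^+ 3 + 16 * g * v i) by ring.
apply: lerD; last first.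
  rewrite ler_wpM2l// I1// lerD2r ler_wpM2l//.
  apply: le_trans (Y3 i); under [leRHS]eq_Rintegral do rewrite exprSr real_normK ?num_real//.
  by [].
by apply: ler_pM => //; apply: Rintegral_ge0 => w _; exact: exprn_ge0.
Qed.

(** By Stein's equation the difference is the mean of [stein' V - V * stein V]. The shift [c] and
    the variance defect multiply quantities bounded by [2]; all the rest is a sum of leave-one-out
    errors. *)
Theorem stein_bound :
  `|\int[Q]_w tailfun x (\sum_(k < n) Y k w + c) - tailfun_mean x| <=
  2 * `|c| + 2 * `|\sum_(i < n) \int[Q]_w Y i w ^+ 2 - 1| +
  160 * (x * (n%:R * b ^+ 3)).
Proof.
have ns := norm_stein x1; have ns' := norm_stein' x1.
have ms := measurable_stein x; have ms' := measurable_stein' x.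
have lsV : L1 (fun w => stein x (V w)) by exact: lb ns.
have lsV' : L1 (fun w => stein' x (V w)) by exact: lb ns'.
have lYV i : L1 (fun w => Y i w * stein x (V w)) by exact: lbM ns.
have lS : L1 (fun w => \sum_(i < n) Y i w * stein x (V w)) by exact: L1_sum.
have lc : L1 (fun w => c * stein x (V w)) by exact: L1Zl.
have lSc := L1D lS lc.
set S := \int[Q]_w stein' x (V w).
pose D i := \int[Q]_w (Y i w * stein x (V w)) - v i * \int[Q]_w stein' x (W i w).
have E : \int[Q]_w tailfun x (V w) - tailfun_mean x =
    (1 - \sum_(i < n) v i) * S - c * \int[Q]_w stein x (V w) +
    \sum_(i < n) (v i * (S - \int[Q]_w stein' x (W i w)) - D i).
  have -> : \int[Q]_w tailfun x (V w) = \int[Q]_w (stein' x (V w) -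
      (\sum_(i < n) Y i w * stein x (V w) + c * stein x (V w)) + tailfun_mean x).
    apply: eq_Rintegral => w _; rewrite -mulr_suml -mulrDl /stein' -/(V w); ring.
  have EB := RintegralB measurableT lsV' lSc.
  have ED := RintegralD measurableT lS lc.
  rewrite (RintegralD measurableT (L1B lsV' lSc) (L1_cst Q (tailfun_mean x))).
  rewrite expectation_cst_real addrK EB ED.
  rewrite RintegralZl// Rintegral_sum// -/S.
  have -> : \sum_(i < n) (v i * (S - \int[Q]_w stein' x (W i w)) - D i) =
    \sum_(i < n) (v i * S - \int[Q]_w (Y i w * stein x (V w))).
    by apply: eq_bigr => i _; rewrite /D; ring.
  by rewrite sumrB -mulr_suml; ring.
rewrite -/V E (le_trans (ler_normD _ _))// addrC.
have B1 : `|(1 - \sum_(i < n) v i) * S - c * \int[Q]_w stein x (V w)| <=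
    2 * `|c| + 2 * `|\sum_(i < n) v i - 1|.
  rewrite (le_trans (ler_normB _ _))// !normrM addrC distrC.
  have S2 : `|S| <= 2 by exact: norm_Rintegral_le_cst.
  have s2 : `|\int[Q]_w stein x (V w)| <= 2 by exact: norm_Rintegral_le_cst.
  by rewrite [X in _ <= X + _]mulrC [X in _ <= _ + X]mulrC lerD// ler_wpM2l.
have B2 : `|\sum_(i < n) (v i * (S - \int[Q]_w stein' x (W i w)) - D i)| <=
    160 * (x * g).
  (* [v i <= b ^+ 2] raises [v i * ((x + 16) * b)] to third order; it joins [(x + 40) * b ^+ 3]. The
     concentration terms [16 g] and [64 g] add up to [80 g]. *)
  apply: (@le_trans _ _ (\sum_(i < n) ((2 * x + 56) * b ^+ 3 + 80 * g * v i))).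
    apply: (le_trans (ler_norm_sum _ _ _)); apply: ler_sum => i _.
    rewrite (le_trans (ler_normB _ _))// normrM (ger0_norm (v0 i)).
    have d1 := diff_stein' i; have d2 := diff_mul_stein i.
    have vb : v i * ((x + 16) * b) <= b ^+ 2 * ((x + 16) * b).
      by rewrite ler_wpM2r ?Y2// mulr_ge0 ?(ltW b0)// addr_ge0.
    have -> : (2 * x + 56) * b ^+ 3 + 80 * g * v i =
      (b ^+ 2 * ((x + 16) * b) + v i * (16 * g)) +
      ((x + 40) * b ^+ 3 + 64 * g * v i) by ring.
    rewrite lerD//; apply: (le_trans (ler_wpM2l (v0 i) d1)).
    by rewrite mulrDr lerD2r.
  rewrite big_split/= sumr_const card_ord -[X in _ + X]mulr_sumr -[X in X + _]mulr_natr.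
  have -> : (2 * x + 56) * b ^+ 3 * n%:R = (2 * x + 56) * g by rewrite /g; ring.
  have : 80 * g * \sum_(i < n) v i <= 80 * g * (5 / 4).
    by rewrite ler_wpM2l// mulr_ge0.
  have : g * 1 <= g * x by rewrite ler_wpM2l.
  (* The total is [(2 x + 56 + 100) g], at most [158 x g] because [x >= 1]. *)
  have arith (s : R) : g * 1 <= g * x -> s <= 80 * g * (5 / 4) ->
    (2 * x + 56) * g + s <= 160 * (x * g) by have := g0; lra.
  exact: arith.
by rewrite addrC lerD.
Qed.

End stein_bound.

(** * Exponential tilting *)

Section exponential_remainder.
Context {R : realType}.
Implicit Types u : R.

Let expR_norm_le (c u : R) : Num.min 0 u <= c <= Num.max 0 u ->
  `|c| <= `|u| /\ expR `|c| <= expR `|u|.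
Proof.
move=> cu; suff cu' : `|c| <= `|u| by rewrite ler_expR.
have := ler_norm u; have := ler_norm (- u); rewrite normrN.
move: cu; rewrite ge_min le_max ler_norml => /andP[/orP[]H1 /orP[]H2]; lra.
Qed.

Let expR_le_norm u : expR u <= expR `|u|.
Proof. by rewrite ler_expR ler_norm. Qed.

(** In this and the next two lemmas the derivative of each remainder is the previous one, so the
    mean value theorem climbs one order at a time; the factor [1 / k!] is given up. *)
Lemma expR_remainder1 u : `|expR u - 1| <= `|u| * expR `|u|.
Proof.
have [c /expR_norm_le[_ cu]] := @is_derive_mvt_minmax R expR expR 0 u
  (fun c _ => is_derive_expR c).
rewrite expR0 subr0 => ->; rewrite normrM mulrC (ger0_norm (expR_ge0 c)).
by rewrite ler_wpM2l// (le_trans (expR_le_norm c)).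
Qed.

Lemma expR_remainder2 u : `|expR u - 1 - u| <= `|u| ^+ 2 * expR `|u|.
Proof.
have dE (c : R) : is_derive c 1 (fun u : R => expR u - u) (expR c - 1).
  by apply: is_derive_eq.
have [c /expR_norm_le[cu ecu]] := is_derive_mvt_minmax (a := 0) (b := u)
  (fun c _ => dE c).
have -> : expR u - u - (expR 0 - 0) = expR u - 1 - u by rewrite expR0; ring.
move=> ->; rewrite subr0 normrM mulrC expr2 -mulrA ler_wpM2l//.
by rewrite (le_trans (expR_remainder1 c))// ler_pM// expR_ge0.
Qed.

Lemma expR_remainder3 u :
  `|expR u - 1 - u - u ^+ 2 / 2| <= `|u| ^+ 3 * expR `|u|.
Proof.
have dE (c : R) : is_derive c 1 (fun u : R => expR u - u - u ^+ 2 / 2) (expR c - 1 - c).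
  by apply: is_derive_eq; rewrite /GRing.scale/=; field.
have [c /expR_norm_le[cu ecu]] := is_derive_mvt_minmax (a := 0) (b := u)
  (fun c _ => dE c).
have -> : expR u - u - u ^+ 2 / 2 - (expR 0 - 0 - 0 ^+ 2 / 2) =
  expR u - 1 - u - u ^+ 2 / 2 by rewrite expR0; ring.
move=> ->; rewrite subr0 normrM mulrC exprS -mulrA ler_wpM2l//.
rewrite (le_trans (expR_remainder2 c))// ler_pM ?expR_ge0 ?exprn_ge0//.
by rewrite lerXn2r// nnegrE.
Qed.

Lemma pow_le_fact_expR (k : nat) u : 0 <= u -> u ^+ k <= k`!%:R * expR u.
Proof.
move=> u0; have k0 : 0 < k`!%:R :> R by rewrite ltr0n fact_gt0.
rewrite -ler_pdivrMl// mulrC; case: k k0 => [|k] k0.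
  by rewrite expr0 fact0 invr1 mulr1 -expR0 ler_expR.
by rewrite (le_trans _ (expR_ge1Dxn k u0))// lerDr.
Qed.

End exponential_remainder.

Section exponential_moment.
Context d (T : measurableType d) (R : realType) (P : probability T R).
Variables (X : T -> R) (h : R).
Hypotheses (mX : measurable_fun setT X) (h0 : 0 < h).
Hypothesis moment : forall j : nat, (2 <= j)%N ->
  (\int[P]_w (`|X w| ^+ j)%:E <= (j`!%:R * h ^+ j)%:E)%E.

Local Notation L1 f := (P.-integrable setT (EFin \o f)).

Lemma L1_moment j : L1 (fun w => `|X w| ^+ j).
Proof.
apply: (@L1_pow_le _ _ _ _ _ _ (maxn 2 j)) => //; first exact: leq_maxr.
apply/integrableP; split.
  by apply/measurable_EFinP/measurable_funX; exact: measurableT_comp.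
under eq_integral do rewrite /= ger0_norm ?exprn_ge0//.
by rewrite (le_lt_trans (moment (leq_maxl _ _)))// ltry.
Qed.

Lemma Rintegral_moment j : (2 <= j)%N ->
  \int[P]_w `|X w| ^+ j <= j`!%:R * h ^+ j.
Proof.
move=> j2; rewrite -lee_fin fineK; first exact: moment.
exact: integrable_fin_num (L1_moment j).
Qed.

(** The moment hypothesis starts at [j = 2]; the first moment is recovered from the second by
    [abs_le_sqr] at scale [h]: [h / 2 + 2 h^2 / (2 h)]. *)
Lemma Rintegral_abs_le : \int[P]_w `|X w| ^+ 1 <= 3 / 2 * h.
Proof.
have l2 := L1_moment 2; have m2 := Rintegral_moment (leqnn 2).
apply: (@le_trans _ _ (\int[P]_w (h / 2 + (2 * h)^-1 * `|X w| ^+ 2))).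
  apply: Rintegral_le; [exact: L1_moment| |].
    by apply: L1D; [exact: L1_cst|exact: L1Zl].
  move=> w; have := abs_le_sqr (X w) h0.
  by rewrite real_normK ?num_real// [_ / (2 * h)]mulrC.
rewrite RintegralD//; [|exact: L1_cst|exact: L1Zl].
rewrite expectation_cst_real RintegralZl//.
have : (2 * h)^-1 * \int[P]_x `|X x| ^+ 2 <= (2 * h)^-1 * (2`!%:R * h ^+ 2).
  by rewrite ler_wpM2l// invr_ge0 mulr_ge0// ltW.
have -> : (2 * h)^-1 * (2`!%:R * h ^+ 2) = h.
  by rewrite (_ : 2`!%:R = 2)//; field; rewrite gt_eqF.
have aux (s t : R) : s <= t -> t / 2 + s <= 3 / 2 * t by lra.
exact: aux.
Qed.

Let Z w := `|X w| / (2 * h).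

Let Z0 w : 0 <= Z w. Proof. by rewrite divr_ge0// mulr_ge0// ltW. Qed.

Let mZ : measurable_fun setT Z.
Proof. by apply: measurable_funM => //; exact: measurableT_comp. Qed.

(** The factorial cancels the one in the moment bound and the [2] in [Z] leaves a geometric term.
    The factor [3 / 2] is what [k = 1] requires. *)
Let term_le k : \int[P]_w (Z w ^+ k / k`!%:R) <= 3 / 2 * 2^-1 ^+ k.
Proof.
have E w : Z w ^+ k / k`!%:R = (k`!%:R * (2 * h) ^+ k)^-1 * `|X w| ^+ k.
  by rewrite /Z expr_div_n invfM mulrC [X in _ * X = _]mulrC mulrA.
under eq_Rintegral do rewrite E.
rewrite RintegralZl//; last exact: L1_moment.
have kp : 0 < k`!%:R :> R by rewrite ltr0n fact_gt0.
have hp : 0 < (2 * h) ^+ k by rewrite exprn_gt0// mulr_gt0.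
rewrite ler_pdivrMl ?mulr_gt0//.
have [|] := leqP 2 k.
  move=> /Rintegral_moment /le_trans; apply.
  have -> : k`!%:R * (2 * h) ^+ k * (3 / 2 * 2^-1 ^+ k) =
      3 / 2 * (k`!%:R * h ^+ k).
    have e : 2 ^+ k * 2^-1 ^+ k = 1 :> R by rewrite -exprMn mulfV// expr1n.
    rewrite exprMn; move: e; move: (2 ^+ k) (2^-1 ^+ k) (h ^+ k) => p q r e.
    by rewrite -[RHS]mulr1 -e; ring.
  by rewrite ler_peMl ?mulr_ge0 ?exprn_ge0 ?(ltW h0)//; lra.
case: k E kp hp => [|[|//]] _ _ _ _.
  by under eq_Rintegral do rewrite expr0; rewrite expectation_cst_real fact0 !expr0; lra.
apply: (le_trans Rintegral_abs_le); rewrite factS fact0 !expr1; have := h0; lra.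
Qed.

(** The exponential series is integrated termwise by monotone convergence; [3] is the sum of the
    geometric bounds of [term_le]. *)
Lemma exp_moment_le :
  L1 (fun w => expR (Z w)) /\ \int[P]_w expR (Z w) <= 3.
Proof.
pose gn (n : nat) w : R := \sum_(0 <= k < n) Z w ^+ k / k`!%:R.
have mt k : measurable_fun setT (fun w => Z w ^+ k / k`!%:R).
  by apply: measurable_funM => //; exact: measurable_funX.
have t0 k w : 0 <= Z w ^+ k / k`!%:R by rewrite divr_ge0// exprn_ge0.
have lt k : L1 (fun w => Z w ^+ k / k`!%:R).
  have E w : Z w ^+ k / k`!%:R = (k`!%:R * (2 * h) ^+ k)^-1 * `|X w| ^+ k.
    by rewrite /Z expr_div_n invfM mulrC [X in _ * X = _]mulrC mulrA.
  by under eq_fun do rewrite E; apply: L1Zl; exact: L1_moment.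
have gn_le n : \int[P]_w gn n w <= 3.
  rewrite /gn Rintegral_sum//.
  apply: (@le_trans _ _ (\sum_(0 <= k < n) 3 / 2 * 2^-1 ^+ k)).
    by apply: ler_sum => k _; exact: term_le.
  have -> : \sum_(0 <= k < n) 3 / 2 * 2^-1 ^+ k = 3 - 3 * 2^-1 ^+ n :> R.
    elim: n => [|n IH]; first by rewrite big_nil expr0; ring.
    by rewrite big_nat_recr//= IH exprS; field.
  by rewrite gerBl mulr_ge0// exprn_ge0.
have lgn n : L1 (gn n) by exact: L1_sum.
have ile : (\int[P]_w (expR (Z w))%:E <= 3%:E)%E.
  have -> : (\int[P]_w (expR (Z w))%:E = limn (fun n => \int[P]_w (gn n w)%:E))%E.
    rewrite -monotone_convergence//.
    - apply: eq_integral => w _; apply/esym/cvg_lim => //.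
      apply: cvg_EFin; first by near=> n.
      have : cvgn (series (exp_coeff (Z w))) by exact: is_cvg_series_exp_coeff.
      by rewrite /expR /=.
    - by move=> n; exact: (measurable_int P (lgn n)).
    - by move=> n w _; rewrite lee_fin; apply: sumr_ge0 => k _; exact: t0.
    - move=> w _ m n mn; rewrite lee_fin.
      by rewrite /gn [leRHS](big_cat_nat (leq0n m) mn)//= lerDl; apply: sumr_ge0.
  apply: lime_le.
    apply: ereal_nondecreasing_is_cvgn => m n mn.
    apply: ge0_le_integral => //.
    + by move=> w _; rewrite lee_fin; apply: sumr_ge0 => k _; exact: t0.
    + exact: (measurable_int P (lgn m)).
    + exact: (measurable_int P (lgn n)).
    + move=> w _; rewrite lee_fin.
      by rewrite /gn [leRHS](big_cat_nat (leq0n m) mn)//= lerDl; apply: sumr_ge0.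
  near=> n; rewrite -[leLHS]fineK; first by rewrite lee_fin; exact: gn_le.
  exact: integrable_fin_num (lgn n).
have lE : L1 (fun w => expR (Z w)).
  apply/integrableP; split.
    by apply/measurable_EFinP; exact: measurableT_comp.
  under eq_integral do rewrite /= ger0_norm ?expR_ge0//.
  by rewrite (le_lt_trans ile)// ltry.
split => //; rewrite -lee_fin fineK//.
exact: integrable_fin_num lE.
Unshelve. all: by end_near. Qed.

End exponential_moment.

Section exponential_tilt.
Context d (T : measurableType d) (R : realType) (P : probability T R).
Variables (X : T -> R) (h x : R).
Hypotheses (mX : measurable_fun setT X) (h0 : 0 < h).
Hypothesis moment : forall j : nat, (2 <= j)%N ->
  (\int[P]_w (`|X w| ^+ j)%:E <= (j`!%:R * h ^+ j)%:E)%E.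
Hypothesis X0 : \int[P]_w X w = 0.
Hypotheses (x0 : 0 < x) (xh : 4000 * (x * h) <= 1).

Local Notation L1 f := (P.-integrable setT (EFin \o f)).

(** With [u = |X| / (4 h)], the exponential moment at hand is that of [e^(2 u)]. One factor [e^u]
    absorbs the power, as [u^k <= k! e^u], and the other absorbs the tilt, as [4 x h <= 1]. *)
Lemma tilted_abs_moment k :
  L1 (fun w => `|X w| ^+ k * expR (x * `|X w|)) /\
  \int[P]_w (`|X w| ^+ k * expR (x * `|X w|)) <= 3 * (k`!%:R * (4 * h) ^+ k).
Proof.
have h4 : 0 < 4 * h by rewrite mulr_gt0.
have x4 : x * (4 * h) <= 1 by have := mulr_gt0 x0 h0; have := xh; lra.
have [lE EE] := exp_moment_le mX h0 moment.
have le w : `|X w| ^+ k * expR (x * `|X w|) <=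
    k`!%:R * (4 * h) ^+ k * expR (`|X w| / (2 * h)).
  set u := `|X w| / (4 * h).
  have u0 : 0 <= u by rewrite divr_ge0// ltW.
  have Xu : `|X w| = 4 * h * u by rewrite /u; field; rewrite gt_eqF.
  have -> : `|X w| / (2 * h) = u + u by rewrite Xu; field; rewrite gt_eqF.
  rewrite expRD Xu exprMn.
  have -> : k`!%:R * (4 * h) ^+ k * (expR u * expR u) =
    (4 * h) ^+ k * (k`!%:R * expR u) * expR u by ring.
  apply: ler_pM; rewrite ?mulr_ge0 ?exprn_ge0 ?expR_ge0 ?(ltW h4)//.
    by rewrite ler_wpM2l ?exprn_ge0 ?(ltW h4)// pow_le_fact_expR.
  by rewrite ler_expR mulrA ler_piMl.
have m : measurable_fun setT (fun w => `|X w| ^+ k * expR (x * `|X w|)).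
  apply: measurable_funM.
    by apply: measurable_funX; exact: measurableT_comp.
  apply: measurableT_comp => //; apply: measurable_funM => //.
  exact: measurableT_comp.
have l : L1 (fun w => `|X w| ^+ k * expR (x * `|X w|)).
  apply: (L1_le m _ (L1Zl (k`!%:R * (4 * h) ^+ k) lE)) => w.
  by rewrite ger0_norm// mulr_ge0 ?exprn_ge0 ?expR_ge0.
split => //; apply: le_trans (Rintegral_le l (L1Zl _ lE) le) _.
rewrite RintegralZl// mulrC ler_wpM2r// mulr_ge0// exprn_ge0// ltW//.
Qed.

Lemma L1_tilt k : L1 (fun w => X w ^+ k * expR (x * X w)).
Proof.
have [l _] := tilted_abs_moment k; apply: (L1_le _ _ l).
  apply: measurable_funM; first exact: measurable_funX.
  by apply: measurableT_comp => //; exact: measurable_funM.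
move=> w; rewrite normrM normrX ler_wpM2l ?exprn_ge0//.
by rewrite ger0_norm ?expR_ge0// ler_expR ler_pM2l// ler_norm.
Qed.

Lemma L1_abs_tilt k : L1 (fun w => `|X w| ^+ k * expR (x * X w)).
Proof.
have := integrable_norm (L1_tilt k); apply: eq_integrable => // w _ /=.
by rewrite normrM normrX (@ger0_norm _ (expR _)) ?expR_ge0.
Qed.

Lemma abs_tilt_le k :
  \int[P]_w (`|X w| ^+ k * expR (x * X w)) <= 3 * (k`!%:R * (4 * h) ^+ k).
Proof.
have [l /(le_trans _)] := tilted_abs_moment k; apply.
apply: Rintegral_le => //; first exact: L1_abs_tilt.
by move=> w; rewrite ler_wpM2l ?exprn_ge0// ler_expR ler_pM2l// ler_norm.
Qed.

Let v := \int[P]_w X w ^+ 2.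
(** The power [0] is kept so that [M], [m1] and [m2] are instances of one family, covered by
    [L1_tilt]. *)
Let M := \int[P]_w (X w ^+ 0 * expR (x * X w)).
Let m1 := \int[P]_w (X w ^+ 1 * expR (x * X w)).
Let m2 := \int[P]_w (X w ^+ 2 * expR (x * X w)).

Let lX : L1 X.
Proof.
apply: (@L1_le _ _ _ _ _ (fun w => `|X w| ^+ 1)) => //.
exact: L1_moment moment 1.
Qed.

Let lX2 : L1 (fun w => X w ^+ 2).
Proof.
have := @L1_moment _ _ _ P X h mX moment 2.
by under eq_fun do rewrite real_normK ?num_real//.
Qed.

Lemma second_moment_le : 0 <= v <= 2 * h ^+ 2.
Proof.
rewrite /v Rintegral_ge0/=; last by move=> w _; exact: sqr_ge0.
have := Rintegral_moment mX moment (leqnn 2).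
by under eq_Rintegral do rewrite real_normK ?num_real//.
Qed.

(** The constant is [3 * 3! * 4^3]. *)
Let cube_le : \int[P]_w (`|X w| ^+ 3 * expR (x * `|X w|)) <= 1152 * h ^+ 3.
Proof.
have [_ /le_trans] := tilted_abs_moment 3; apply.
by rewrite (_ : 3`!%:R = 6)// exprMn; lra.
Qed.

Let L1_cube := (tilted_abs_moment 3).1.

(** Shared by the three expansions below: the weight [X^j] goes with the exponential remainder of
    order [3 - j], so the error is always governed by [|X|^3 e^(x |X|)]. *)
Let remainder (f : T -> R) (k : R) : L1 f -> 0 <= k ->
  (forall w, `|f w| <= k * (`|X w| ^+ 3 * expR (x * `|X w|))) ->
  `|\int[P]_w f w| <= k * (1152 * h ^+ 3).
Proof.
move=> lf k0 fk; apply: (le_trans (norm_Rintegral_le lf (L1Zl k L1_cube) fk)).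
by rewrite RintegralZl// ler_wpM2l.
Qed.

Let norm_xX w : `|x * X w| = x * `|X w|.
Proof. by rewrite normrM gtr0_norm. Qed.

Lemma mgf_remainder : `|M - 1 - x ^+ 2 * v / 2| <= x ^+ 3 * (1152 * h ^+ 3).
Proof.
have E w : X w ^+ 0 * expR (x * X w) = (expR (x * X w) - 1 - x * X w - (x * X w) ^+ 2 / 2) +
    (1 + x * X w + x ^+ 2 / 2 * X w ^+ 2) by rewrite expr0; field.
have l1 : L1 (fun w => x * X w) by exact: L1Zl.
have l2 : L1 (fun w => x ^+ 2 / 2 * X w ^+ 2) by exact: L1Zl.
have l01 : L1 (fun w => 1 + x * X w) by apply: L1D => //; exact: L1_cst.
have l012 := L1D l01 l2.
have lr : L1 (fun w => expR (x * X w) - 1 - x * X w - (x * X w) ^+ 2 / 2).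
  have := L1B (L1_tilt 0) l012; apply: eq_integrable => // w _ /=.
  by congr EFin; rewrite expr0; field.
have := remainder lr (exprn_ge0 3 (ltW x0)) _; rewrite /M.
under [in X in _ -> X]eq_Rintegral do rewrite E.
rewrite (RintegralD measurableT lr l012) (RintegralD measurableT l01 l2).
rewrite (RintegralD measurableT (L1_cst _ 1) l1) expectation_cst_real.
rewrite RintegralZl// X0 RintegralZl// -/v.
set r := \int[P]_x0 _; have -> : r + (1 + x * 0 + x ^+ 2 / 2 * v) - 1 - x ^+ 2 * v / 2 = r.
  by field.
apply => w; apply: (le_trans (expR_remainder3 _)).
by rewrite norm_xX exprMn le_eqVlt; apply/orP; left; apply/eqP; ring.
Qed.

Lemma mgf1_remainder : `|m1 - x * v| <= x ^+ 2 * (1152 * h ^+ 3).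
Proof.
have E w : X w ^+ 1 * expR (x * X w) = X w * (expR (x * X w) - 1 - x * X w) +
    (X w + x * X w ^+ 2) by rewrite expr1; ring.
have l2 : L1 (fun w => x * X w ^+ 2) by exact: L1Zl.
have l12 := L1D lX l2.
have lr : L1 (fun w => X w * (expR (x * X w) - 1 - x * X w)).
  have := L1B (L1_tilt 1) l12; apply: eq_integrable => // w _ /=.
  by congr EFin; rewrite expr1; ring.
have := remainder lr (exprn_ge0 2 (ltW x0)) _; rewrite /m1.
under [in X in _ -> X]eq_Rintegral do rewrite E.
rewrite (RintegralD measurableT lr l12) (RintegralD measurableT lX l2).
rewrite X0 RintegralZl// -/v add0r addrK.
apply => w; rewrite normrM.
apply: (le_trans (ler_wpM2l (normr_ge0 _) (expR_remainder2 _))).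
by rewrite norm_xX exprMn le_eqVlt; apply/orP; left; apply/eqP; ring.
Qed.

Lemma mgf2_remainder : `|m2 - v| <= x * (1152 * h ^+ 3).
Proof.
have lr : L1 (fun w => X w ^+ 2 * expR (x * X w) - X w ^+ 2).
  by apply: L1B => //; exact: L1_tilt.
have := remainder lr (ltW x0) _; rewrite /m2 /v -RintegralB//; last exact: L1_tilt.
apply => w; have -> : X w ^+ 2 * expR (x * X w) - X w ^+ 2 =
  X w ^+ 2 * (expR (x * X w) - 1) by ring.
rewrite normrM; apply: (le_trans (ler_wpM2l (normr_ge0 _) (expR_remainder1 _))).
by rewrite norm_xX normrX le_eqVlt; apply/orP; left; apply/eqP; ring.
Qed.

(** From [e^u >= 1 + u] and the zero mean. Thanks to it, dividing by [M] never enlarges an error. *)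
Lemma mgf_ge1 : 1 <= M.
Proof.
have l1 : L1 (fun w => x * X w) by exact: L1Zl.
have := RintegralD measurableT (L1_cst P 1) l1.
rewrite expectation_cst_real RintegralZl// X0 mulr0 addr0 => {1}<-.
apply: Rintegral_le => //.
- by apply: L1D => //; exact: L1_cst.
- exact: L1_tilt.
- by move=> w; rewrite expr0 mul1r expR_ge1Dx.
Qed.

End exponential_tilt.

(** * Normalized tilted moments: estimates on real numbers only *)

Section tilt_estimates.
Context {R : realType}.
Variables (x h v M m1 m2 : R).
Hypotheses (x0 : 0 < x) (h0 : 0 < h) (xh : 4000 * (x * h) <= 1).
Hypothesis v_bnd : 0 <= v <= 2 * h ^+ 2.
Hypothesis M1 : 1 <= M.
Hypothesis M_rem : `|M - 1 - x ^+ 2 * v / 2| <= x ^+ 3 * (1152 * h ^+ 3).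
Hypothesis m1_rem : `|m1 - x * v| <= x ^+ 2 * (1152 * h ^+ 3).
Hypothesis m2_rem : `|m2 - v| <= x * (1152 * h ^+ 3).

Let t := x * h.

Let t0 : 0 < t. Proof. exact: mulr_gt0. Qed.

Let M0 : 0 < M. Proof. exact: lt_le_trans M1. Qed.

Let M_le : M - 1 <= 2 * t ^+ 2.
Proof.
have [v0 v2] := andP v_bnd.
have A : x ^+ 2 * v <= x ^+ 2 * (2 * h ^+ 2) by rewrite ler_wpM2l// sqr_ge0.
have B : x ^+ 3 * (1152 * h ^+ 3) = t ^+ 2 * (1152 * t) by rewrite /t; ring.
have C : t ^+ 2 * (1152 * t) <= t ^+ 2 * 1.
  apply: ler_wpM2l; first exact: sqr_ge0.
  by have := xh; have := t0; rewrite -/t; move: t => u; lra.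
have D : x ^+ 2 * (2 * h ^+ 2) = 2 * t ^+ 2 by rewrite /t; ring.
have := M_rem; rewrite ler_norml B => /andP[_]; move: A C; rewrite D.
move: (x ^+ 2 * v) (t ^+ 2) (t ^+ 2 * _) => p q r; lra.
Qed.

(** Write [m / M - s = (m - s - s (M - 1)) / M] and use [1 / M <= 1] and [M - 1 <= 2 t^2]. *)
Let div_rem (m s e : R) : 0 <= s -> `|m - s| <= e ->
  `|m / M - s| <= e + s * (2 * t ^+ 2).
Proof.
move=> s0 ms.
have -> : m / M - s = (m - s - s * (M - 1)) / M by field; rewrite gt_eqF.
rewrite normrM normfV (gtr0_norm M0) ler_pdivrMr//.
have M10 : 0 <= M - 1 by rewrite subr_ge0.
have le1 : `|m - s - s * (M - 1)| <= e + s * (2 * t ^+ 2).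
  apply: (le_trans (ler_normB _ _)); rewrite lerD// normrM !ger0_norm//.
  by rewrite ler_wpM2l.
by rewrite (le_trans le1)// ler_peMr// (le_trans _ le1).
Qed.

(** [ln M] lies between [M - 1 - (M - 1)^2] and [M - 1], the lower bound coming from
    [ln (1 / M) <= 1 / M - 1]. The square is at most [4 t^4 <= t^3], which fits in the slack between
    [1152] and [1200]. *)
Lemma tilt_log_mgf : `|ln M - x ^+ 2 * v / 2| <= 1200 * (x ^+ 3 * h ^+ 3).
Proof.
have arith (l m p q r s : R) : l <= m - 1 -> m - 1 - s <= l -> s <= 4 * r ->
    4 * r <= q -> 0 <= q -> - (1152 * q) <= m - 1 - p / 2 <= 1152 * q ->
    - (1200 * q) <= l - p / 2 <= 1200 * q by lra.
have up : ln M <= M - 1.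
  have := @le_ln1Dx R (M - 1); have -> : 1 + (M - 1) = M by ring.
  by apply; have := M0; lra.
have lo : (M - 1) - (M - 1) ^+ 2 <= ln M.
  have : ln M^-1 <= M^-1 - 1.
    have := @le_ln1Dx R (M^-1 - 1); have -> : 1 + (M^-1 - 1) = M^-1 by ring.
    by apply; have : 0 < M^-1 by [rewrite invr_gt0]; lra.
  rewrite lnV// => H; apply: (@le_trans _ _ (1 - M^-1)); last by move: H; lra.
  rewrite -subr_ge0.
  have -> : 1 - M^-1 - (M - 1 - (M - 1) ^+ 2) = (M - 1) ^+ 3 / M.
    by field; rewrite gt_eqF.
  by rewrite divr_ge0 ?exprn_ge0 ?subr_ge0// ltW.
have sq : (M - 1) ^+ 2 <= 4 * t ^+ 4.
  have -> : 4 * t ^+ 4 = (2 * t ^+ 2) ^+ 2 by ring.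
  by rewrite ler_sqr ?nnegrE ?subr_ge0// mulr_ge0// sqr_ge0.
have t4 : 4 * t ^+ 4 <= t ^+ 3.
  have -> : 4 * t ^+ 4 = t ^+ 3 * (4 * t) by ring.
  apply: ler_piMr; first by rewrite exprn_ge0// ltW.
  by have := xh; have := t0; rewrite -/t; move: t => u; lra.
have E : x ^+ 3 * h ^+ 3 = t ^+ 3 by rewrite /t; ring.
have := M_rem; rewrite mulrCA E !ler_norml.
have := exprn_ge0 3 (ltW t0); move: up lo sq t4.
exact: arith.
Qed.

Let xv : 0 <= x * v <= 2 * (x * h ^+ 2).
Proof.
have [v0 v2] := andP v_bnd; rewrite mulr_ge0 ?(ltW x0)//=.
by rewrite [leRHS]mulrCA ler_wpM2l// ltW.
Qed.

Let t_small (p : R) : 0 <= p -> 4000 * (p * t) <= p.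
Proof.
by move=> p0; rewrite mulrCA; apply: ler_piMr => //; exact: xh.
Qed.

Lemma tilt_mean : `|m1 / M - x * v| <= 1200 * (x ^+ 2 * h ^+ 3).
Proof.
have arith (a b c : R) : 0 <= c -> a <= 4 * b -> 4000 * b <= c ->
    1152 * c + a <= 1200 * c by lra.
have [p0 p1] := andP xv.
apply: (le_trans (div_rem p0 m1_rem)); rewrite mulrCA.
have pos : 0 <= x ^+ 2 * h ^+ 3 by rewrite mulr_ge0// exprn_ge0// ltW.
apply: arith pos _ (t_small pos).
have -> : 4 * (x ^+ 2 * h ^+ 3 * t) = 2 * (x * h ^+ 2) * (2 * t ^+ 2).
  by rewrite /t; ring.
by rewrite ler_wpM2r// mulr_ge0// sqr_ge0.
Qed.

(** The tilted mean is at most [3 x h^2] in absolute value, so its square is at most [9 t] times the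
    target order [x h^3] and is absorbed since [t = x h] is small. *)
Lemma tilt_variance : `|m2 / M - (m1 / M) ^+ 2 - v| <= 1200 * (x * h ^+ 3).
Proof.
have arith1 (a b c e : R) : 0 <= b -> b <= 2 * e -> 0 <= e ->
    `|a - b| <= 1200 * c -> 4000 * c <= e -> `|a| <= 3 * e.
  by rewrite !ler_norml; lra.
have arith2 (w a s u e f : R) : 0 <= f -> `|w - s| <= 1152 * f + u ->
    u <= 4 * e -> 0 <= a -> a <= 9 * e -> 4000 * e <= f ->
    `|w - a - s| <= 1200 * f.
  by rewrite !ler_norml; lra.
have [v0 v2] := andP v_bnd; have [p0 p1] := andP xv.
have pos : 0 <= x * h ^+ 3 by rewrite mulr_ge0// ?exprn_ge0// ltW.
have pos2 : 0 <= x * h ^+ 2 by rewrite mulr_ge0// ?exprn_ge0// ltW.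
have d2 : `|m2 / M - v| <= 1152 * (x * h ^+ 3) + v * (2 * t ^+ 2).
  by rewrite [1152 * _]mulrCA; exact: div_rem v0 m2_rem.
have q : v * (2 * t ^+ 2) <= 4 * (x * h ^+ 3 * t).
  have -> : 4 * (x * h ^+ 3 * t) = 2 * h ^+ 2 * (2 * t ^+ 2) by rewrite /t; ring.
  by rewrite ler_wpM2r// mulr_ge0// sqr_ge0.
have a3 : `|m1 / M| <= 3 * (x * h ^+ 2).
  have tm := tilt_mean.
  have E2 : x ^+ 2 * h ^+ 3 = x * h ^+ 2 * t by rewrite /t; ring.
  by rewrite E2 in tm; exact: arith1 p0 p1 pos2 tm (t_small pos2).
have a9 : (m1 / M) ^+ 2 <= 9 * (x * h ^+ 3 * t).
  have -> : 9 * (x * h ^+ 3 * t) = (3 * (x * h ^+ 2)) ^+ 2 by rewrite /t; ring.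
  rewrite -[(m1 / M) ^+ 2]real_normK ?num_real// ler_sqr ?nnegrE ?normr_ge0//.
  by rewrite mulr_ge0.
exact: arith2 pos d2 q (sqr_ge0 _) a9 (t_small pos).
Qed.

End tilt_estimates.

(** * The tilted product measure *)

Section tilted_product.
Context d (T : measurableType d) (R : realType) (P : probability T R) (n : nat).
Variables (X : 'I_n -> T -> R) (x : R).
Hypothesis mX : forall i, measurable_fun setT (X i).
Hypothesis indX : mutually_independent P X.
Hypothesis lE : forall i, P.-integrable setT (EFin \o (fun w => expR (x * X i w))).

Local Notation L1 mu f := (mu.-integrable setT (EFin \o f)).

Let M i := \int[P]_w expR (x * X i w).

Hypothesis M_gt0 : forall i, 0 < M i.

(** By independence this is [e^(x S) / E(e^(x S))]; in product form each factor normalizes its own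
    variable. *)
Let density w := \prod_(i < n) (expR (x * X i w) / M i).

(** One identity with three uses: constants [1] give the total mass, a single nontrivial factor
    gives the marginals, and indicators give independence under the tilt. *)
Let prod_indep (F : 'I_n -> R -> R) : (forall i, measurable_fun setT (F i)) ->
  (forall i, L1 P (fun w => F i (X i w) * expR (x * X i w))) ->
  L1 P (fun w => (\prod_(i < n) F i (X i w)) * density w) /\
  \int[P]_w ((\prod_(i < n) F i (X i w)) * density w) =
  \prod_(i < n) (\int[P]_w (F i (X i w) * expR (x * X i w)) / M i).
Proof.
move=> mF lF; pose G i y := F i y * expR (x * y) / M i.
have mG i : measurable_fun setT (G i).
  apply: measurable_funM => //; apply: measurable_funM => //.
  by apply: measurableT_comp => //; exact: measurable_funM.
have lG i : L1 P (fun w => G i (X i w)).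
  have := L1Zl (M i)^-1 (lF i); apply: eq_integrable => // w _ /=.
  by rewrite mulrC.
have [lp Ep] := Rintegral_prod_indep (mutually_independent_comp indX mG) lG.
have E w : (\prod_(i < n) F i (X i w)) * density w = \prod_(i < n) G i (X i w).
  by rewrite -big_split/=; apply: eq_bigr => i _; rewrite mulrA.
rewrite (funext E); split => //.
rewrite Ep; apply: eq_bigr => i _; rewrite /G RintegralZr//.
Qed.

Let prod_indep1 := prod_indep (fun=> measurable_cst (1 : R)).

Let l1 i : L1 P (fun w => 1 * expR (x * X i w)).
Proof. by under eq_fun do rewrite mul1r. Qed.

Lemma measurable_density : measurable_fun setT density.
Proof.
apply: measurable_prod => i _; apply: measurable_funM => //.
by apply: measurableT_comp => //; exact: measurable_funM.
Qed.

Lemma density_ge0 w : 0 <= density w.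
Proof. by apply: prodr_ge0 => i _; rewrite divr_ge0 ?expR_ge0 ?(ltW (M_gt0 i)). Qed.

Lemma integral_density : (\int[P]_w (density w)%:E = 1)%E.
Proof.
have [lp Ep] := prod_indep1 l1.
have E w : \prod_(i < n) (1 : R) * density w = density w by rewrite big1// mul1r.
have {}lp : L1 P density by move: lp; under eq_fun do rewrite E.
rewrite -[LHS]fineK; last exact: integrable_fin_num lp.
congr EFin; rewrite -[LHS]/(\int[P]_w density w).
move: Ep; rewrite (funext E) => ->; apply: big1 => i _.
under eq_Rintegral do rewrite mul1r.
by rewrite -/(M i) mulfV// gt_eqF.
Qed.

Definition tilted : probability T R :=
  tilt measurable_density density_ge0 integral_density.

Lemma tilted_marginal i (f : R -> R) : measurable_fun setT f ->
  L1 P (fun w => f (X i w) * expR (x * X i w)) ->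
  L1 tilted (fun w => f (X i w)) /\
  \int[tilted]_w f (X i w) = \int[P]_w (f (X i w) * expR (x * X i w)) / M i.
Proof.
move=> mf lf; pose F k : R -> R := if k == i then f else cst 1.
have mF k : measurable_fun setT (F k) by rewrite /F; case: eqP.
have lF k : L1 P (fun w => F k (X k w) * expR (x * X k w)).
  by rewrite /F; case: eqP => [->|_] //; exact: l1.
have [lp Ep] := prod_indep mF lF.
have E w : \prod_(k < n) F k (X k w) = f (X i w).
  rewrite (bigD1 i)//= {1}/F eqxx big1 ?mulr1// => k ki.
  by rewrite /F (negbTE ki).
have mfX : measurable_fun setT (fun w => f (X i w)) by exact: measurableT_comp.
have lfD : L1 P (fun w => f (X i w) * density w).
  by move: lp; under eq_fun do rewrite E.
split; first exact: integrable_tilt.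
rewrite /tilted /= Rintegral_tilt//.
move: Ep; under eq_Rintegral do rewrite E.
move=> ->; rewrite (bigD1 i)//= /F eqxx big1 ?mulr1// => k ki.
rewrite (negbTE ki); under eq_Rintegral do rewrite mul1r.
by rewrite -/(M k) mulfV// gt_eqF.
Qed.

Lemma tilted_indep : mutually_independent tilted X.
Proof.
move=> B mB.
have mind i : measurable_fun setT (\1_(B i) : R -> R) by exact: measurable_indic.
have mXB i : measurable (X i @^-1` B i) by rewrite -[_ @^-1` _]setTI; exact: mX.
have lind i : L1 P (fun w => \1_(B i) (X i w) * expR (x * X i w)).
  apply: (L1_le _ _ (lE i)).
    apply: measurable_funM; first exact: measurableT_comp.
    by apply: measurableT_comp => //; exact: measurable_funM.
  move=> w; rewrite normrM (ger0_norm (expR_ge0 _)) ler_piMl ?expR_ge0//.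
  by rewrite ger0_norm// indicE lern1 leq_b1.
have QB i : tilted (X i @^-1` B i) =
    (\int[P]_w (\1_(B i) (X i w) * expR (x * X i w)) / M i)%:E.
  have [_ <-] := tilted_marginal (mind i) (lind i).
  rewrite /Rintegral; have -> : (\int[tilted]_w (\1_(B i) (X i w))%:E =
    \int[tilted]_w (\1_(X i @^-1` B i) w)%:E)%E by [].
  by rewrite integral_indic// setIT fineK// fin_num_measure.
under eq_bigr do rewrite QB.
rewrite prodEFin.
have [lp <-] := prod_indep mind lind.
pose A := \bigcap_(i in [set: 'I_n]) (X i @^-1` B i).
have mA : measurable A.
  by apply: fin_bigcap_measurable => //; exact: finite_finset.
have E w : \prod_(i < n) \1_(B i) (X i w) = \1_A w :> R.
  rewrite indicE; have [wA|wA] := boolP (w \in A).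
    apply: big1 => i _; rewrite indicE mem_set//.
    by move: wA; rewrite inE => /(_ i I).
  have [i Bi] : exists i, ~ B i (X i w).
    apply: contrapT => /forallNP H; move: wA; rewrite notin_setE; apply => i _ /=.
    by apply: contrapT; exact: H.
  by rewrite (bigD1 i)//= indicE memNset// mul0r.
under [in RHS]eq_Rintegral do rewrite E.
have lA : L1 P (fun w => \1_A w * density w) by move: lp; under eq_fun do rewrite E.
rewrite -(Rintegral_tilt measurable_density density_ge0 integral_density _ lA)//.
by rewrite /Rintegral integral_indic// setIT fineK// fin_num_measure.
Qed.

Lemma tilted_expectation (f : T -> R) : measurable_fun setT f ->
  L1 P (fun w => f w * density w) ->
  \int[tilted]_w f w = \int[P]_w (f w * density w).
Proof. exact: Rintegral_tilt. Qed.

End tilted_product.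

(** * The tail estimate *)

Section moderate_deviation.
Context d (T : measurableType d) (R : realType) (P : probability T R) (n : nat).
Variables (X : 'I_n -> T -> R) (h x : R).
Hypothesis mX : forall i, measurable_fun setT (X i).
Hypothesis indX : mutually_independent P X.
Hypothesis X0 : forall i, \int[P]_w X i w = 0.
Hypothesis moment : forall i (j : nat), (2 <= j)%N ->
  (\int[P]_w (`|X i w| ^+ j)%:E <= (j`!%:R * h ^+ j)%:E)%E.
Hypothesis var1 : \sum_(i < n) \int[P]_w X i w ^+ 2 = 1.
Hypotheses (h0 : 0 < h) (x1 : 1 <= x).

Let E3 : R := n%:R * h ^+ 3.

Hypothesis small : 10000 * (x ^+ 3 * E3) <= 1.

Local Notation L1 mu f := (mu.-integrable setT (EFin \o f)).

Let x0 : 0 < x. Proof. exact: lt_le_trans x1. Qed.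

Let E3_ge0 : 0 <= E3. Proof. by rewrite mulr_ge0// exprn_ge0// ltW. Qed.

Let v i := \int[P]_w X i w ^+ 2.

Let v_bnd i : 0 <= v i <= 2 * h ^+ 2.
Proof. exact: (second_moment_le (mX i) (moment i)). Qed.

(** Total variance [1] and [v i <= 2 h^2] give [1 <= 2 n h^2], hence
    [x h <= x^3 h * 2 n h^2 = 2 x^3 E3]. *)
Let xh : 5000 * (x * h) <= 1.
Proof.
have nh : 1 <= 2 * (n%:R * h ^+ 2).
  rewrite -[X in X <= _]var1; apply: (@le_trans _ _ (\sum_(i < n) 2 * h ^+ 2)).
    by apply: ler_sum => i _; case/andP: (v_bnd i).
  by rewrite sumr_const card_ord -[X in X <= _]mulr_natr le_eqVlt; apply/orP; left;
    apply/eqP; ring.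
have xx : x <= x ^+ 3 by rewrite ler_eXnr.
have A : x * h * 1 <= x ^+ 3 * h * (2 * (n%:R * h ^+ 2)).
  by rewrite ler_pM ?mulr_ge0 ?(ltW x0) ?(ltW h0)// ler_wpM2r// ltW.
have B : x ^+ 3 * h * (2 * (n%:R * h ^+ 2)) = 2 * (x ^+ 3 * E3) by rewrite /E3; ring.
by move: small A; rewrite B; move: (x ^+ 3 * E3) (x * h) => p q; lra.
Qed.

Let xh4 : 4000 * (x * h) <= 1.
Proof. by have := xh; have := mulr_gt0 x0 h0; lra. Qed.

Let M i := \int[P]_w (X i w ^+ 0 * expR (x * X i w)).
Let m1 i := \int[P]_w (X i w ^+ 1 * expR (x * X i w)).
Let m2 i := \int[P]_w (X i w ^+ 2 * expR (x * X i w)).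

Let lX k i : L1 P (fun w => X i w ^+ k * expR (x * X i w)).
Proof. by have := L1_tilt (mX i) h0 (moment i) x0 xh4 k. Qed.

Let lE i : L1 P (fun w => expR (x * X i w)).
Proof. by have := lX 0 i; under eq_fun do rewrite expr0 mul1r. Qed.

Let ME i : \int[P]_w expR (x * X i w) = M i.
Proof. by rewrite /M; under [RHS]eq_Rintegral do rewrite expr0 mul1r. Qed.

Let M1 i : 1 <= M i.
Proof. exact: (mgf_ge1 (mX i) h0 (moment i) (X0 i) x0 xh4). Qed.

Let M0 i : 0 < \int[P]_w expR (x * X i w).
Proof. by rewrite ME (lt_le_trans _ (M1 i)). Qed.

Let Q : probability T R := tilted mX indX lE M0.

Let QE i (f : R -> R) : measurable_fun setT f ->
  L1 P (fun w => f (X i w) * expR (x * X i w)) ->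
  L1 Q (fun w => f (X i w)) /\
  \int[Q]_w f (X i w) = \int[P]_w (f (X i w) * expR (x * X i w)) / M i.
Proof. by move=> mf lf; rewrite -ME; exact: tilted_marginal. Qed.

Let a i := m1 i / M i.
Let Y i w := X i w - a i.
Let c := \sum_(i < n) a i - x.

Let QX k i : L1 Q (fun w => X i w ^+ k) /\
  \int[Q]_w X i w ^+ k = \int[P]_w (X i w ^+ k * expR (x * X i w)) / M i.
Proof.
by have := @QE i (fun y => y ^+ k); apply => //; exact: measurable_funX.
Qed.

Let QabsX k i : L1 Q (fun w => `|X i w| ^+ k) /\
  \int[Q]_w `|X i w| ^+ k <= 3 * (k`!%:R * (4 * h) ^+ k).
Proof.
have [|l E] := @QE i (fun y => `|y| ^+ k) _ (L1_abs_tilt (mX i) h0 (moment i) x0 xh4 k).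
  by apply: measurable_funX.
split=> //; rewrite E ler_pdivrMr; last exact: lt_le_trans (M1 i).
apply: (le_trans (abs_tilt_le (mX i) h0 (moment i) x0 xh4 k)).
by rewrite ler_peMr ?mulr_ge0 ?exprn_ge0 ?mulr_ge0 ?(ltW h0).
Qed.

Let lQX i : L1 Q (X i).
Proof. by have [l _] := QX 1 i; move: l. Qed.

Let EQX i : \int[Q]_w X i w = a i.
Proof. by have [_ e] := QX 1 i; move: e. Qed.

Let mY i : measurable_fun setT (Y i).
Proof. exact: measurable_funB. Qed.

Let indY : mutually_independent Q Y.
Proof.
apply: (@mutually_independent_comp _ _ _ _ _ _
  (tilted_indep mX indX lE M0) (fun i y => y - a i)).
by move=> i; exact: measurable_funB.
Qed.

Let a_le i : `|a i| <= 12 * h.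
Proof.
rewrite -EQX; have [l le] := QabsX 1 i.
apply: (le_trans (norm_Rintegral_le (lQX i) l _)); first by move=> w; rewrite expr1.
by apply: (le_trans le); rewrite factS fact0 expr1; lra.
Qed.

Let absY k i w : `|Y i w| ^+ k <= (`|X i w| + 12 * h) ^+ k.
Proof.
rewrite lerXn2r// ?nnegrE ?addr_ge0 ?mulr_ge0 ?(ltW h0)//.
by rewrite (le_trans (ler_normB _ _))// lerD2l.
Qed.

Let lY3 i : L1 Q (fun w => `|Y i w| ^+ 3).
Proof.
have l3 := (QabsX 3 i).1; have l2 := (QabsX 2 i).1; have l1 := (QabsX 1 i).1.
apply: (@L1_le _ _ _ _ _ (fun w => `|X i w| ^+ 3 + 36 * h * `|X i w| ^+ 2
    + 3 * (12 * h) ^+ 2 * `|X i w| ^+ 1 + (12 * h) ^+ 3)).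
- by apply: measurable_funX; exact: measurableT_comp.
- move=> w; rewrite ger0_norm ?exprn_ge0// (le_trans (absY 3 i w))//.
  by rewrite le_eqVlt; apply/orP; left; apply/eqP; ring.
- apply: L1D; last exact: L1_cst; apply: L1D; last exact: L1Zl.
  by apply: L1D => //; exact: L1Zl.
Qed.

(** Under [Q] both the mean of [|X i|] and [|a i|] are at most [12 h]. The first moment of [Y i]
    fixes the value; the bounds on the second and third fit with room. *)
Let b : R := 24 * h.

Let Y0 i : \int[Q]_w Y i w = 0.
Proof. by rewrite RintegralB//; [rewrite EQX expectation_cst_real subrr|exact: L1_cst]. Qed.

Let Y1 i : \int[Q]_w `|Y i w| <= b.
Proof.
have [l le] := QabsX 1 i; have lY := L1_of_cube mY lY3 i.
apply: (@le_trans _ _ (\int[Q]_w (`|X i w| ^+ 1 + 12 * h))).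
  apply: Rintegral_le => //; first exact: integrable_norm.
    by apply: L1D => //; exact: L1_cst.
  by move=> w; have := absY 1 i w; rewrite !expr1.
rewrite RintegralD//; last exact: L1_cst.
rewrite expectation_cst_real; move: le; rewrite factS fact0 expr1 /b.
move: (\int[Q]_w _) => p; lra.
Qed.

Let EY2 i : \int[Q]_w Y i w ^+ 2 = m2 i / M i - a i ^+ 2.
Proof.
have [l2 e2] := QX 2 i.
have E w : Y i w ^+ 2 = (X i w ^+ 2 - 2 * a i * X i w) + a i ^+ 2 by rewrite /Y; ring.
under eq_Rintegral do rewrite E.
have la : L1 Q (fun w => 2 * a i * X i w) by exact: L1Zl.
rewrite (RintegralD measurableT (L1B l2 la) (L1_cst _ _)) (RintegralB measurableT l2 la).
by rewrite e2 RintegralZl// EQX expectation_cst_real -/(m2 i); ring.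
Qed.

Let Y2 i : \int[Q]_w Y i w ^+ 2 <= b ^+ 2.
Proof.
rewrite EY2; have [l le] := QabsX 2 i.
have -> : m2 i / M i = \int[Q]_w `|X i w| ^+ 2.
  rewrite -(QX 2 i).2; apply: eq_Rintegral => w _.
  by rewrite real_normK ?num_real.
apply: (@le_trans _ _ (\int[Q]_w `|X i w| ^+ 2)); first by rewrite gerBl sqr_ge0.
apply: (le_trans le); rewrite (_ : 2`!%:R = 2)// /b.
have := sqr_ge0 h; rewrite !exprMn; lra.
Qed.

Let Y3 i : \int[Q]_w `|Y i w| ^+ 3 <= b ^+ 3.
Proof.
have [l le] := QabsX 3 i.
apply: (@le_trans _ _ (\int[Q]_w (4 * `|X i w| ^+ 3 + 4 * (12 * h) ^+ 3))).
  apply: Rintegral_le => //.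
    by apply: L1D; [exact: L1Zl|exact: L1_cst].
  move=> w; apply: (le_trans (absY 3 i w)).
  have := normr_ge0 (X i w); move: `|X i w| => p p0.
  have q0 : 0 <= 12 * h by rewrite mulr_ge0// ltW.
  move: (12 * h) q0 => q q0; rewrite -subr_ge0.
  have -> : 4 * p ^+ 3 + 4 * q ^+ 3 - (p + q) ^+ 3 = 3 * (p + q) * (p - q) ^+ 2 by ring.
  by apply: mulr_ge0; [rewrite mulr_ge0// addr_ge0|exact: sqr_ge0].
rewrite RintegralD//; [|exact: L1Zl|exact: L1_cst].
rewrite expectation_cst_real RintegralZl//.
(* [4 * (1152 + 12^3) = 11520], below [24^3 = 13824]. *)
move: le; rewrite (_ : 3`!%:R = 6)// /b !exprMn.
have := exprn_ge0 3 (ltW h0); move: (\int[Q]_w _) (h ^+ 3) => p q; lra.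
Qed.

Let mgf_rem i := mgf_remainder (mX i) h0 (moment i) (X0 i) x0 xh4.
Let mgf1_rem i := mgf1_remainder (mX i) h0 (moment i) (X0 i) x0 xh4.
Let mgf2_rem i := mgf2_remainder (mX i) h0 (moment i) x0 xh4.

Let sum_le (u : 'I_n -> R) (e : R) : (forall i, `|u i| <= 1200 * (e * h ^+ 3)) ->
  `|\sum_(i < n) u i| <= 1200 * (e * E3).
Proof.
move=> ue; apply: (le_trans (ler_norm_sum _ _ _)).
apply: (@le_trans _ _ (\sum_(i < n) 1200 * (e * h ^+ 3))); first exact: ler_sum.
rewrite sumr_const card_ord -[X in X <= _]mulr_natr /E3.
by rewrite le_eqVlt; apply/orP; left; apply/eqP; ring.
Qed.

Let c_le : `|c| <= 1200 * (x ^+ 2 * E3).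
Proof.
have -> : c = \sum_(i < n) (a i - x * v i) by rewrite sumrB -mulr_sumr var1 mulr1.
apply: (@sum_le (fun i => a i - x * v i)) => i.
exact: tilt_mean x0 h0 xh4 (v_bnd i) (M1 i) (mgf_rem i) (mgf1_rem i).
Qed.

Let var_le : `|\sum_(i < n) \int[Q]_w Y i w ^+ 2 - 1| <= 1200 * (x * E3).
Proof.
rewrite -[X in `|_ - X|]var1 -sumrB.
apply: (@sum_le (fun i => \int[Q]_w Y i w ^+ 2 - v i) x) => i; rewrite EY2.
exact: tilt_variance x0 h0 xh4 (v_bnd i) (M1 i) (mgf_rem i) (mgf1_rem i) (mgf2_rem i).
Qed.

Let log_le : `|\sum_(i < n) ln (M i) - x ^+ 2 / 2| <= 1200 * (x ^+ 3 * E3).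
Proof.
have -> : x ^+ 2 / 2 = \sum_(i < n) x ^+ 2 * v i / 2.
  rewrite -mulr_suml -mulr_sumr /v var1; ring.
rewrite -sumrB; apply: (@sum_le (fun i => ln (M i) - x ^+ 2 * v i / 2)) => i.
exact: tilt_log_mgf x0 h0 xh4 (v_bnd i) (M1 i) (mgf_rem i).
Qed.

(** Twice [1200] for the shift and twice [1200] for the variance defect, plus the Stein error with
    [b = 24 h]. *)
Let B : R := 4800 + 160 * 24 ^+ 3.

Let xpow : [/\ x * E3 <= x ^+ 2 * E3, x ^+ 2 * E3 <= x ^+ 3 * E3 &
  0 <= x * E3].
Proof.
split; last by rewrite mulr_ge0// ltW.
- by rewrite ler_wpM2r// ler_eXnr.
- by rewrite ler_wpM2r// ler_weXn2l.
Qed.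

Let tail_mean : `|\int[Q]_w tailfun x (\sum_(i < n) Y i w + c) - tailfun_mean x| <=
  B * (x ^+ 2 * E3).
Proof.
have [p1 p2 p0] := xpow.
have arith (s p q r : R) : 10000 * r <= 1 -> q <= r -> p <= q -> 0 <= p ->
    `|s - 1| <= 1200 * p -> 3 / 4 <= s <= 5 / 4.
  by rewrite ler_norml; lra.
have arith2 (s q r : R) : 10000 * r <= 1 -> q <= r -> s <= 1200 * q -> s <= 1.
  by lra.
have b0 : 0 < b by rewrite mulr_gt0.
have c1 : `|c| <= 1 := arith2 _ _ _ small p2 c_le.
have /andP[v1 v2] := arith _ _ _ _ small p2 p1 p0 var_le.
have b2 : b ^+ 2 <= 4^-1.
  have h1 : 5000 * h <= 1.
    have hx : h <= x * h by rewrite ler_peMl// ltW.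
    by have := xh; lra.
  have -> : 4^-1 = 2^-1 ^+ 2 :> R by field.
  rewrite ler_sqr ?nnegrE ?(ltW b0)// /b; have := h0; lra.
apply: (le_trans (stein_bound mY indY lY3 Y0 b0 Y1 Y2 Y3 b2 c1 v1 v2 x1)).
have -> : x * (n%:R * b ^+ 3) = 24 ^+ 3 * (x * E3) by rewrite /b /E3; ring.
have L0 : 0 <= (24 : R) ^+ 3 by rewrite exprn_ge0.
have : 24 ^+ 3 * (x * E3) <= 24 ^+ 3 * (x ^+ 2 * E3) by rewrite ler_wpM2l.
rewrite /B mulrDl -mulrA; move: c_le var_le p1.
move: `|c| `|_ - 1| (24 ^+ 3 * (x * E3)) (24 ^+ 3 * (x ^+ 2 * E3)) => s t u w.
move: (x * E3) (x ^+ 2 * E3) => e f; lra.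
Qed.

Let S w := \sum_(i < n) X i w.
Let p : R := \int[P]_w (S w <= x)%R%:R.

Let mS : measurable_fun setT S. Proof. exact: measurable_sum. Qed.

Let mind : measurable_fun setT (fun w => (S w <= x)%R%:R : R).
Proof. by apply: measurable_ler_ind. Qed.

Let lind : L1 P (fun w => (S w <= x)%R%:R).
Proof.
by apply: (@L1_bounded _ _ _ _ _ 1) => // w; rewrite normr_nat lern1 leq_b1.
Qed.

(** On [S > x] the factor [e^(-x (S - x))] of [tailfun] cancels the growth of the density, so their
    product is a constant times the indicator of [S > x]. *)
Let tail_prob : 1 - p = expR (\sum_(i < n) ln (M i) - x ^+ 2) *
  \int[Q]_w tailfun x (\sum_(i < n) Y i w + c).
Proof.
have YS w : \sum_(i < n) Y i w + c = S w - x by rewrite sumrB /c /S; ring.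
under eq_Rintegral do rewrite YS.
pose f w := tailfun x (S w - x).
have mf : measurable_fun setT f.
  apply: measurableT_comp; first exact: measurable_tailfun.
  exact: measurable_funB.
set r := expR _.
have r0 : 0 < r by exact: expR_gt0.
have fD w : f w * \prod_(i < n) (expR (x * X i w) / \int[P]_w expR (x * X i w)) =
    r^-1 * (1 - (S w <= x)%R%:R).
  have -> : \prod_(i < n) (expR (x * X i w) / \int[P]_w expR (x * X i w)) =
      expR (x * S w) / expR (\sum_(i < n) ln (M i)).
    rewrite big_split/= -expR_sum mulr_sumr; congr (_ * _).
    rewrite prodfV expR_sum; congr (_^-1); apply: eq_bigr => i _.
    by rewrite ME lnK// posrE (lt_le_trans _ (M1 i)).
  rewrite /f /tailfun subr_gt0 ltNge; case: (S w <= x) => /=.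
    by rewrite mul0r subrr mulr0.
  rewrite subr0 mulr1 /r -!expRN -!expRD; congr expR; ring.
have lfD : L1 P (fun w => f w * \prod_(i < n)
    (expR (x * X i w) / \int[P]_w expR (x * X i w))).
  rewrite (funext fD); apply: L1Zl; apply: L1B => //; exact: L1_cst.
rewrite -/f (tilted_expectation mX indX lE M0 mf lfD) (funext fD).
rewrite RintegralZl//; last by apply: L1B => //; exact: L1_cst.
rewrite RintegralB//; last exact: L1_cst.
by rewrite expectation_cst_real -/p mulrA mulfV ?mul1r// gt_eqF.
Qed.

(** With the common factor [e^(-x^2/2)] removed, [e^r * e] is compared with [N], [r] being the error
    of the log-moment generating function. In the constant, [60] is the bound [2] of [e^r] times the
    [30] of [mills_lb], and [2400] is [2 * 1200]. *)
Theorem moderate_deviation_bound :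
  `|(1 - \int[P]_w (\sum_(i < n) X i w <= x)%R%:R) - (1 - Phi x)| <=
  (60 * (4800 + 160 * 24 ^+ 3) / normal_peak 1 + 2400) *
    (x ^+ 3 * (n%:R * h ^+ 3)) * (1 - Phi x).
Proof.
rewrite -/p -/B -/E3.
have c0p := @normal_peak1_gt0 R; set c0 := normal_peak 1 in c0p *.
set N := tailfun_mean x; set q := x ^+ 2 / 2.
have PhiE : 1 - Phi x = expR (- q) * N.
  rewrite /N /tailfun_mean /mills -/c0 -/q expRN; field.
  by rewrite !gt_eqF ?expR_gt0.
have N0 : 0 <= N by exact: tailfun_mean_ge0.
set e := \int[Q]_w tailfun x (\sum_(i < n) Y i w + c).
set r := \sum_(i < n) ln (M i) - q.
have pE : 1 - p = expR (- q) * (expR r * e).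
  by rewrite tail_prob mulrA -expRD -/e; congr (expR _ * _); rewrite /r /q; field.
set D := x ^+ 3 * E3; have D0 : 0 <= D by rewrite mulr_ge0// exprn_ge0// ltW.
have r_le : `|r| <= 1200 * D by exact: log_le.
have r_half : `|r| <= 2^-1 by move: r_le; have := small; rewrite -/D; move: `|r| => s; lra.
have er2 : expR `|r| <= 2.
  have : 2^-1 <= expR (- `|r|).
    by apply: le_trans (expR_ge1Dx _); move: r_half; move: `|r| => s; lra.
  by rewrite expRN lef_pV2 ?posrE ?expR_gt0.
have er1 : `|expR r - 1| <= 2400 * D.
  apply: (le_trans (expR_remainder1 r)).
  apply: (@le_trans _ _ (1200 * D * 2)); last by move: D0; lra.
  by rewrite ler_pM ?expR_ge0.
have eN : `|e - N| <= 30 * B / c0 * D * N.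
  apply: (le_trans tail_mean).
  (* Turns the absolute error into a relative one, at the cost of one more factor [x]. *)
  have xm : 1 <= 30 * x * mills x.
    by have := mills_lb x1; rewrite -[X in X <= _]mulr1 ler_pdivrMl ?mulr_gt0.
  have B0 : 0 <= B * (x ^+ 2 * E3).
    apply: mulr_ge0; last exact: mulr_ge0 (sqr_ge0 _) E3_ge0.
    apply: addr_ge0; first exact: ler0n.
    by apply: mulr_ge0; [exact: ler0n|apply: exprn_ge0; exact: ler0n].
  apply: (@le_trans _ _ (B * (x ^+ 2 * E3) * (30 * x * mills x))).
    by rewrite ler_peMr.
  rewrite le_eqVlt; apply/orP; left; apply/eqP.
  by rewrite /N /tailfun_mean -/c0 /D; field; rewrite gt_eqF.
rewrite pE PhiE -mulrBr normrM (ger0_norm (expR_ge0 _)).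
rewrite [leRHS]mulrCA ler_wpM2l ?expR_ge0//.
have -> : expR r * e - N = expR r * (e - N) + (expR r - 1) * N by ring.
apply: (le_trans (ler_normD _ _)).
rewrite (normrM (expR r)) (normrM (expR r - 1)) (ger0_norm (expR_ge0 _)) (ger0_norm N0).
have A1 : expR r * `|e - N| <= 2 * (30 * B / c0 * D * N).
  rewrite ler_pM ?expR_ge0//.
  by rewrite (le_trans _ er2)// ler_expR ler_norm.
have A2 : `|expR r - 1| * N <= 2400 * D * N by rewrite ler_wpM2r.
apply: (le_trans (lerD A1 A2)).
by rewrite le_eqVlt; apply/orP; left; apply/eqP; ring.
Qed.

End moderate_deviation.

(** * Rescaling to unit total variance *)

Section normalization.
Context d (T : measurableType d) (R : realType) (P : probability T R) (m : nat).
Variables (X : 'I_m -> T -> R) (sigma delta C x : R).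
Hypothesis m0 : (0 < m)%N.
Hypothesis indX : mutually_independent P X.
Hypothesis lX : forall i, X i \in Lfun P 2%:E.
Hypothesis EX : forall i, ('E_P[X i] = 0)%E.
Hypothesis sigmaE : sigma = Num.sqrt (m%:R^-1 * \sum_(i < m) fine ('V_P[X i])).
Hypothesis sigma1 : 1 <= sigma.
Hypothesis C1 : 1 <= C.
Hypothesis moment : forall (i : 'I_m) (j : nat), (2 <= j)%N ->
  ('E_P[(fun w => `|X i w| ^+ j)%R] <=
    (j`!%:R * (C * sigma) `^ ((1 + delta) * j%:R))%:E)%E.
Hypothesis x1 : 1 <= x.

Let s := sigma * Num.sqrt m%:R.
Let h := (C * sigma) `^ (1 + delta) / s.
Let Y i w := X i w / s.

Let mX i : measurable_fun setT (X i).
Proof. by have /andP[/[!inE]] := lX i. Qed.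

Let sigma0 : 0 < sigma. Proof. exact: lt_le_trans sigma1. Qed.

Let rm0 : 0 < Num.sqrt (m%:R : R). Proof. by rewrite sqrtr_gt0 ltr0n. Qed.

Let s0 : 0 < s. Proof. exact: mulr_gt0. Qed.

Let h0 : 0 < h.
Proof. by rewrite divr_gt0// powR_gt0// mulr_gt0// (lt_le_trans _ C1). Qed.

Let hE : h = C `^ (1 + delta) * sigma `^ delta / Num.sqrt m%:R.
Proof.
have C0 : 0 <= C by exact: le_trans C1.
have E : sigma `^ (1 + delta) = sigma * sigma `^ delta.
  rewrite powRD; last by rewrite (gt_eqF sigma0) implybT.
  by rewrite powRr1// ltW.
rewrite /h powRM ?(ltW sigma0)// E /s; field.
by rewrite !gt_eqF.
Qed.

Let mY i : measurable_fun setT (Y i).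
Proof. exact: measurable_funM. Qed.

Let indY : mutually_independent P Y.
Proof.
apply: (@mutually_independent_comp _ _ _ _ _ _ indX (fun i y => y / s)).
by move=> i; exact: measurable_funM.
Qed.

Let lX1 i : P.-integrable setT (EFin \o X i).
Proof.
apply/Lfun1_integrable; apply: Lfun_subset12 (lX i).
exact: fin_num_measure.
Qed.

Let X0 i : \int[P]_w X i w = 0.
Proof. by have := EX i; rewrite unlock /Rintegral => ->. Qed.

Let Y0 i : \int[P]_w Y i w = 0.
Proof. by rewrite RintegralZr// X0 mul0r. Qed.

Let momentY i (j : nat) : (2 <= j)%N ->
  (\int[P]_w (`|Y i w| ^+ j)%:E <= (j`!%:R * h ^+ j)%:E)%E.
Proof.
move=> j2; have sj : 0 < s ^+ j by rewrite exprn_gt0.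
have E w : (`|Y i w| ^+ j)%:E = ((s ^+ j)^-1%:E * (`|X i w| ^+ j)%:E)%E.
  by rewrite /Y normrM normfV (gtr0_norm s0) expr_div_n -EFinM mulrC.
under eq_integral do rewrite E.
rewrite ge0_integralZl_EFin//; last 2 first.
- by apply/measurable_EFinP/measurable_funX; exact: measurableT_comp.
- by rewrite invr_ge0 ltW.
have H : (0 <= (s ^+ j)^-1%:E)%E by rewrite lee_fin invr_ge0 ltW.
have := moment i j2; rewrite unlock => M; apply: (le_trans (lee_wpmul2l H M)).
rewrite -EFinM lee_fin le_eqVlt; apply/orP; left; apply/eqP.
rewrite powRrM powR_mulrn ?powR_ge0// /h expr_div_n; field.
by rewrite gt_eqF.
Qed.

Let varY : \sum_(i < m) \int[P]_w Y i w ^+ 2 = 1.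
Proof.
have lX2 i : P.-integrable setT (EFin \o (fun w => X i w ^+ 2)).
  apply/Lfun1_integrable; exact: (Lfun2_mul_Lfun1 (lX i) (lX i)).
have V i : fine 'V_P[X i] = \int[P]_w X i w ^+ 2.
  rewrite varianceE// EX expe2 mul0e sube0 unlock; congr fine.
have E i : \int[P]_w Y i w ^+ 2 = s ^- 2 * \int[P]_w X i w ^+ 2.
  rewrite -RintegralZl//; apply: eq_Rintegral => w _.
  by rewrite /Y exprMn exprVn mulrC.
under eq_bigr do rewrite E -V.
rewrite -mulr_sumr.
have S0 : 0 <= \sum_(i < m) fine 'V_P[X i].
  by apply: sumr_ge0 => i _; rewrite fine_ge0// variance_ge0.
have : sigma ^+ 2 = m%:R^-1 * \sum_(i < m) fine 'V_P[X i].
  by rewrite sigmaE sqr_sqrtr// mulr_ge0// invr_ge0.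
move=> S2; have mN : m%:R != 0 :> R by rewrite pnatr_eq0 -lt0n.
have -> : \sum_(i < m) fine 'V_P[X i] = m%:R * sigma ^+ 2.
  by rewrite S2 mulrA mulfV// mul1r.
rewrite /s exprMn sqr_sqrtr// [X in _^-1 * X]mulrC mulVf//.
by rewrite mulf_neq0// expf_neq0// gt_eqF.
Qed.

(** Here [x^3 m h^3] is exactly the cube of [C^(1 + delta)] times the quantity assumed to tend to
    [0], which is why smallness is stated through that cube. *)
Lemma normalized_bound :
  10000 * (C `^ (1 + delta) * (x * sigma `^ delta / m%:R `^ (6%:R^-1))) ^+ 3 <= 1 ->
  `|(1 - fine (P [set w | (\sum_(i < m) X i w) / (sigma * Num.sqrt m%:R) <= x]))
    - (1 - Phi x)| <=
  (60 * (4800 + 160 * 24 ^+ 3) / normal_peak 1 + 2400) * C `^ (1 + delta) ^+ 3 *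
   (sigma `^ (3%:R * delta) * x ^+ 3 / Num.sqrt m%:R) * (1 - Phi x).
Proof.
have E3 : x ^+ 3 * (m%:R * h ^+ 3) =
    C `^ (1 + delta) ^+ 3 * (sigma `^ (3%:R * delta) * x ^+ 3 / Num.sqrt m%:R).
  have -> : sigma `^ (3%:R * delta) = (sigma `^ delta) ^+ 3.
    by rewrite mulrC powRrM powR_mulrn ?powR_ge0.
  have mE : m%:R = Num.sqrt m%:R ^+ 2 :> R by rewrite sqr_sqrtr.
  rewrite hE [X in X * _ ^+ 3]mE; field.
  by rewrite gt_eqF.
have small : (x * sigma `^ delta / m%:R `^ (6%:R^-1)) ^+ 3 =
    sigma `^ (3%:R * delta) * x ^+ 3 / Num.sqrt m%:R.
  have -> : sigma `^ (3%:R * delta) = (sigma `^ delta) ^+ 3.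
    by rewrite mulrC powRrM powR_mulrn ?powR_ge0.
  rewrite expr_div_n exprMn -(powR_mulrn 3 (powR_ge0 m%:R 6^-1)) -powRrM.
  have -> : 6^-1 * 3%:R = 2^-1 :> R by field.
  by rewrite powR12_sqrt// [in LHS]mulrC; ring.
rewrite exprMn small -E3 => H.
have := moderate_deviation_bound mY indY Y0 momentY varY h0 x1 H.
have -> : \int[P]_w (\sum_(i < m) Y i w <= x)%R%:R =
    fine (P [set w | (\sum_(i < m) X i w) / (sigma * Num.sqrt m%:R) <= x]).
  set A := [set w | _].
  have mA : measurable A.
    rewrite -[A]setTI; apply: measurable_fun_le => //.
    by apply: measurable_funM => //; exact: measurable_sum.
  rewrite -(setIT A) -integral_indic//; congr fine; apply: eq_integral => w _.
  rewrite indicE /A /= -mulr_suml -/s; congr (_%:R)%:E.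
  by rewrite mem_setE.
by rewrite E3 (mulrA _ (C `^ (1 + delta) ^+ 3)).
Qed.

End normalization.

Theorem theorem3p1 (R : realType) (d : measure_display)
  (T : nat -> measurableType d) (P : forall m, probability (T m) R)
  (X : forall m, 'I_m -> T m -> R) (delta C : R) (x : nat -> R) :
  (forall m, (0 < m)%N -> mutually_independent (P m) (X m)) ->
  (forall m (i : 'I_m), X m i \in Lfun (P m) 2%:E) ->
  (forall m (i : 'I_m), ('E_(P m)[X m i] = 0)%E) ->
  (forall m, (0 < m)%N -> 1 <= sigma_row P X m) ->
  0 <= delta < 1 -> 1 <= C ->
  (forall m (i : 'I_m) (j : nat), (2 <= j)%N ->
     ('E_(P m)[(fun w => `|X m i w| ^+ j)%R] <=
      (j`!%:R * (C * sigma_row P X m) `^ ((1 + delta) * j%:R))%:E)%E) ->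
  (fun m => sigma_row P X m `^ delta / m%:R `^ (6%:R^-1)) @ \oo --> 0 ->
  x @ \oo --> +oo ->
  (fun m => x m * sigma_row P X m `^ delta / m%:R `^ (6%:R^-1)) @ \oo --> 0 ->
  exists K : R, \forall m \near \oo,
    `| (1 - F_row P X m (x m)) - (1 - Phi (x m)) | <=
      K * (sigma_row P X m `^ (3%:R * delta) * x m ^+ 3 / Num.sqrt m%:R)
        * (1 - Phi (x m)).
Proof.
move=> indX lX EX sigma1 _ C1 moment _ xoo ucvg.
set C' := C `^ (1 + delta).
have C'0 : 0 < C' by rewrite powR_gt0// (lt_le_trans _ C1).
exists ((60 * (4800 + 160 * 24 ^+ 3) / normal_peak 1 + 2400) * C' ^+ 3).
(* The smallness condition bears on the cube, and [22^3 = 10648] exceeds [10000]. *)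
have e0 : 0 < (22 * C')^-1 by rewrite invr_gt0 mulr_gt0.
near=> m.
have m0 : (0 < m)%N by near: m; exact: nbhs_infty_gt.
have x1 : 1 <= x m by near: m; move/cvgryPge : xoo; exact.
have ule : `|x m * sigma_row P X m `^ delta / m%:R `^ (6%:R^-1)| <= (22 * C')^-1.
  by near: m; move/cvgr0Pnorm_le : ucvg => /(_ _ e0).
apply: (normalized_bound m0 (indX m m0) (lX m) (EX m) erefl (sigma1 m m0) C1
  (moment m) x1).
rewrite -/C'; set u := _ / _ in ule *.
have u0 : 0 <= u by rewrite divr_ge0 ?powR_ge0// mulr_ge0 ?powR_ge0// (le_trans _ x1).
have uC : 22 * (C' * u) <= 1.
  move: ule; rewrite (ger0_norm u0) => ule.
  by rewrite mulrA -ler_pdivlMl ?mulr_gt0// mulr1.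
have w0 : 0 <= C' * u by rewrite mulr_ge0// ltW.
move: (C' * u) w0 uC => w w0 uC.
have : (22 * w) ^+ 3 <= 1 by rewrite exprn_ile1// mulr_ge0.
rewrite exprMn; have := exprn_ge0 3 w0; move: (w ^+ 3) => q q0; lra.
Unshelve. all: by end_near. Qed.
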